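(* Let $T$ be a complete o-minimal theory in a language $\mathcal L$ extending the theory of ordered abelian groups, with a distinguished positive constant $1$, such that $T$ has quantifier elimination and a universal axiomatization. Let $\mathcal L(\mathfrak f)$ be $\mathcal L$ expanded by a new unary function symbol $\mathfrak f$, let $T(\mathfrak f)$ be a complete $\mathcal L(\mathfrak f)$-theory extending $T$, and let $\mathbb M$ be a monster model of $T(\mathfrak f)$. Suppose: \begin{itemize} \item[(i)] $T(\mathfrak f)$ has quantifier elimination. \item[(ii)] For every $(\mathcal C,\mathfrak f)\models T(\mathfrak f)$, every $\mathcal B\preceq\mathcal C$ with $\mathfrak f(\mathcal B)\subseteq\mathcal B$ and every $c\in\mathcal C^k$, there are $l\in\mathbb N$ and $d\in\mathfrak f(\mathcal B\langle c\rangle)^l$ such that $\mathfrak f(\mathcal B\langle c\rangle)\subseteq\langle \mathfrak f(\mathcal B),d\rangle$. \item[(iii)] For all $m\ge n$, all $\mathcal L$-terms $g,h$ of arities $m+k$ and $n+l$ respectively, all $b_1\in\mathbb M^k$, $b_2\in\mathfrak f(\mathbb M)^l$, and every indiscernible sequence $(a_i)_{i\in I}$ from $\mathfrak f(\mathbb M)^n\times\mathbb M^{m-n}$, writing $a_i=(a_{i,1},\dots,a_{i,m})$, such that $I=I_1+(c)+I_2$ with $I_1,I_2$ infinite without endpoints, $(a_i)_{i\in I_1+I_2}$ is $b_1b_2$-indiscernible, and $\mathfrak f(g(a_i,b_1))=h(a_{i,1},\dots,a_{i,n},b_2)$ for every $i\in I_1+I_2$, we have $\mathfrak f(g(a_c,b_1))=h(a_{c,1},\dots,a_{c,n},b_2)$.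 \end{itemize} Then $T(\mathfrak f)$ is distal.
   Context: For a subset $X$ of a model of $T$, $\langle X\rangle$ denotes the $\mathcal L$-substructure generated by $X$ (which equals the $\mathcal L$-definable closure of $X$), and for $\mathcal B\preceq\mathcal A$ and $X\subseteq \mathcal A$, $\mathcal B\langle X\rangle$ denotes $\langle \mathcal B\cup X\rangle$; $\langle\mathfrak f(\mathcal B),d\rangle$ is the substructure generated by $\mathfrak f(\mathcal B)$ together with the coordinates of $d$. ''$b$-indiscernible'' means indiscernible over the set of coordinates of $b$. A complete theory with monster model $\mathbb M$ is distal if for every small $A\subseteq\mathbb M$ and every indiscernible sequence $(a_i)_{i\in I}$ from $\mathbb M^p$ with $I=I_1+(c)+I_2$ (concatenation, $I_1,I_2$ infinite linear orders without endpoints, $c$ a single element) such that $(a_i)_{i\in I_1+I_2}$ is $A$-indiscernible, the whole sequence $(a_i)_{i\in I}$ is $A$-indiscernible. *)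

(* Defs.v *)
From mathcomp Require Import all_boot all_order.
From mathcomp Require Import all_classical.

Set Implicit Arguments.
Unset Strict Implicit.
Unset Printing Implicit Defensive.

Local Open Scope classical_set_scope.
Local Open Scope card_scope.

(* Symbols are indexed by their arity. *)
Record language : Type := Language {
  fsym : nat -> Type;
  rsym : nat -> Type
}.

(* Variables range over an arbitrary type [V]; a formula with parameters from
   a set [A] is a formula whose variables live in [V + A]. *)
Inductive term (L : language) (V : Type) : Type :=
| tvar : V -> term L V
| tapp : forall n : nat, fsym L n -> ('I_n -> term L V) -> term L V.

Arguments tvar {L V} _.
Arguments tapp {L V n} _ _.

(* In [fall phi] the bound variable of [phi] is [None]. *)
Inductive formula (L : language) (V : Type) : Type :=
| feq : term L V -> term L V -> formula L V
| frel : forall n : nat, rsym L n -> ('I_n -> term L V) -> formula L V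
| fbot : formula L V
| fimp : formula L V -> formula L V -> formula L V
| fall : formula L (option V) -> formula L V.

Arguments feq {L V} _ _.
Arguments frel {L V n} _ _.
Arguments fbot {L V}.
Arguments fimp {L V} _ _.
Arguments fall {L V} _.

Record structure (L : language) : Type := Structure {
  dom :> Type;
  dom_inhabited : inhabited dom;
  fun_int : forall n : nat, fsym L n -> ('I_n -> dom) -> dom;
  rel_int : forall n : nat, rsym L n -> ('I_n -> dom) -> Prop
}.

Arguments fun_int {L} _ {n} _ _.
Arguments rel_int {L} _ {n} _ _.

Fixpoint eval (L : language) (M : structure L) (V : Type) (v : V -> M)
    (t : term L V) : M :=
  match t with
  | tvar x => v x
  | tapp _ s args => fun_int M s (fun i => eval v (args i))
  end.

Fixpoint sat (L : language) (M : structure L) (V : Type) (phi : formula L V) :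
    (V -> M) -> Prop :=
  match phi with
  | feq t u => fun v => eval v t = eval v u
  | frel _ r args => fun v => rel_int M r (fun i => eval v (args i))
  | fbot => fun _ => False
  | fimp phi1 phi2 => fun v => sat phi1 v -> sat phi2 v
  | fall psi => fun v => forall x : M, sat psi (oapp v x)
  end.

Definition vsum (V W D : Type) (v : V -> D) (w : W -> D) (x : V + W) : D :=
  match x with inl y => v y | inr z => w z end.

Fixpoint quantifier_free (L : language) (V : Type) (phi : formula L V) : Prop :=
  match phi with
  | feq _ _ | frel _ _ _ | fbot => True
  | fimp phi1 phi2 => quantifier_free phi1 /\ quantifier_free phi2
  | fall _ => False
  end.

Fixpoint universal (L : language) (V : Type) (phi : formula L V) : Prop :=
  match phi with
  | fall psi => universal psi
  | psi => quantifier_free psi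
  end.

Definition sentence (L : language) : Type := formula L void.

Definition theory (L : language) : Type := set (sentence L).

Definition holds (L : language) (M : structure L) (s : sentence L) : Prop :=
  sat s (@of_void M).

Definition models (L : language) (M : structure L) (T : theory L) : Prop :=
  forall s : sentence L, T s -> holds M s.

Definition complete (L : language) (T : theory L) : Prop :=
  (exists M : structure L, models M T) /\
  forall s : sentence L,
    (forall M : structure L, models M T -> holds M s) \/
    (forall M : structure L, models M T -> ~ holds M s).

Definition quantifier_elimination (L : language) (T : theory L) : Prop :=
  forall (n : nat) (phi : formula L 'I_n),
  exists2 psi : formula L 'I_n, quantifier_free psi &
    forall M : structure L, models M T ->
    forall a : 'I_n -> M, sat phi a <-> sat psi a.

Definition universally_axiomatizable (L : language) (T : theory L) : Prop :=
  exists2 U : theory L, (forall s, U s -> universal s) &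
    forall M : structure L, models M T <-> models M U.

Definition fun_closed (L : language) (M : structure L) (B : set M) : Prop :=
  forall (n : nat) (s : fsym L n) (args : 'I_n -> M),
    (forall i, B (args i)) -> B (fun_int M s args).

Record substructure (L : language) (M : structure L) : Type := Substructure {
  sub_set :> set M;
  sub_nonempty : sub_set !=set0;
  sub_closed : fun_closed sub_set
}.

Lemma induced_inhabited (L : language) (M : structure L)
  (B : substructure M) : inhabited B.
Proof.
by case: (sub_nonempty B) => x /mem_set Bx; exact: (inhabits (exist _ x Bx)).
Qed.

Lemma induced_closed (L : language) (M : structure L) (B : substructure M)
  (n : nat) (s : fsym L n) (args : 'I_n -> B) :
  fun_int M s (fun i => set_val (args i)) \in (B : set M).
Proof. by apply/mem_set/sub_closed => i; exact/set_mem/(valP (args i)). Qed.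

Definition induced (L : language) (M : structure L) (B : substructure M) :
    structure L :=
  @Structure L B (induced_inhabited B)
    (fun n s args =>
       exist (fun x => x \in (B : set M)) _ (induced_closed s args))
    (fun n r args => rel_int M r (fun i => set_val (args i))).

Definition elementary (L : language) (M : structure L)
    (B : substructure M) : Prop :=
  forall (n : nat) (phi : formula L 'I_n) (b : 'I_n -> B),
    @sat L (induced B) _ phi b <-> @sat L M _ phi (fun i => set_val (b i)).

Inductive generated (L : language) (M : structure L) (X : set M) : set M :=
| gen_base : forall x : M, X x -> generated X x
| gen_app : forall (n : nat) (s : fsym L n) (args : 'I_n -> M),
    (forall i, generated X (args i)) -> generated X (fun_int M s args).

(* The additive inverse is not required to be named by a symbol. *)
Record oag_symbols (L : language) : Type := OagSymbols {
  sym_lt : rsym L 2;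
  sym_add : fsym L 2;
  sym_zero : fsym L 0;
  sym_one : fsym L 0
}.

Definition args0 (D : Type) (i : 'I_0) : D := False_rect D (notF (ltn_ord i)).

Definition args2 (D : Type) (x y : D) (i : 'I_2) : D :=
  if (i : nat) is 0 then x else y.

Section OrderedGroup.
Context (L : language) (S : oag_symbols L) (M : structure L).

Definition lt_int (x y : M) : Prop := rel_int M (sym_lt S) (args2 x y).
Definition add_int (x y : M) : M := fun_int M (sym_add S) (args2 x y).
Definition zero_int : M := fun_int M (sym_zero S) (@args0 M).
Definition one_int : M := fun_int M (sym_one S) (@args0 M).

Record ordered_abelian_group : Prop := OrderedAbelianGroup {
  oag_addA : associative add_int;
  oag_addC : commutative add_int;
  oag_add0 : left_id zero_int add_int;
  oag_addN : forall x, exists y, add_int x y = zero_int;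
  oag_irr : forall x, ~ lt_int x x;
  oag_trans : forall x y z, lt_int x y -> lt_int y z -> lt_int x z;
  oag_total : forall x y, [\/ lt_int x y, x = y | lt_int y x];
  oag_ltD : forall x y z, lt_int x y -> lt_int (add_int x z) (add_int y z)
}.

(* [None] stands for -oo as a lower bound and for +oo as an upper bound. *)
Definition open_interval (lo hi : option M) : set M :=
  [set x | (if lo is Some a then lt_int a x else True) /\
           (if hi is Some b then lt_int x b else True)].

Definition o_minimal : Prop :=
  forall phi : formula L (unit + M),
  exists (n k : nat) (p : 'I_n -> M) (lo hi : 'I_k -> option M),
    [set x : M | sat phi (vsum (fun=> x) id)] =
    range p `|` \bigcup_(j in [set: 'I_k]) open_interval (lo j) (hi j).

End OrderedGroup.

Definition extends_oag (L : language) (S : oag_symbols L) (T : theory L) : Prop :=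
  forall M : structure L, models M T ->
    ordered_abelian_group S M /\ lt_int S (zero_int S M) (one_int S M).

Definition o_minimal_theory (L : language) (S : oag_symbols L)
    (T : theory L) : Prop :=
  forall M : structure L, models M T -> o_minimal S M.

Inductive fsym_expand (L : language) : nat -> Type :=
| old_sym : forall n : nat, fsym L n -> fsym_expand L n
| new_sym : fsym_expand L 1.

Arguments old_sym {L n} _.
Arguments new_sym {L}.

Definition expand (L : language) : language :=
  Language (fsym_expand L) (rsym L).

Definition reduct (L : language) (M : structure (expand L)) : structure L :=
  @Structure L M (dom_inhabited M)
    (fun n s => @fun_int (expand L) M n (old_sym s))
    (fun n r => @rel_int (expand L) M n r).

Definition new_fun (L : language) (M : structure (expand L)) (x : M) : M :=
  @fun_int (expand L) M 1 new_sym (fun=> x).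

Definition extends_theory (L : language) (T : theory L)
    (Tf : theory (expand L)) : Prop :=
  forall M : structure (expand L), models M Tf -> models (reduct M) T.

Definition card_lt (X Y : Type) (A : set X) (B : set Y) : Prop :=
  A #<= B /\ ~ (B #<= A).

(* The cardinal bounding the small sets is that of the type [kappa]. *)
Definition small (kappa : Type) (X : Type) (A : set X) : Prop :=
  card_lt A [set: kappa].

Definition saturated (kappa : Type) (L : language) (M : structure L) : Prop :=
  forall A : set M, small kappa A ->
  forall (n : nat) (p : set (formula L ('I_n + A))),
    (forall q, finite_set q -> q `<=` p ->
       exists a : 'I_n -> M, forall phi, q phi -> sat phi (vsum a set_val)) ->
    exists a : 'I_n -> M, forall phi, p phi -> sat phi (vsum a set_val).

Record automorphism (L : language) (M : structure L) (s : M -> M) : Prop :=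
  Automorphism {
    aut_bij : bijective s;
    aut_fun : forall n (f : fsym L n) (args : 'I_n -> M),
      s (fun_int M f args) = fun_int M f (fun i => s (args i));
    aut_rel : forall n (r : rsym L n) (args : 'I_n -> M),
      rel_int M r args <-> rel_int M r (fun i => s (args i))
  }.

Definition partial_elementary (L : language) (M : structure L) (A : set M)
    (g : A -> M) : Prop :=
  forall (n : nat) (phi : formula L 'I_n) (a : 'I_n -> A),
    @sat L M _ phi (fun i => set_val (a i)) <-> @sat L M _ phi (fun i => g (a i)).

Definition strongly_homogeneous (kappa : Type) (L : language)
    (M : structure L) : Prop :=
  forall (A : set M) (g : A -> M), small kappa A -> partial_elementary g ->
  exists2 s : M -> M, automorphism s & forall x : A, s (set_val x) = g x.

(* The set of formulas in countably many variables has size |L| + aleph_0. *)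
Record monster (kappa : Type) (L : language) (T : theory L)
    (M : structure L) : Prop := Monster {
  monster_models : models M T;
  monster_large : small kappa [set: formula L nat];
  monster_saturated : saturated kappa M;
  monster_homogeneous : strongly_homogeneous kappa M
}.

Definition increasing_tuple (d : Order.disp_t) (I : orderType d) (n : nat)
    (i : 'I_n -> I) : Prop :=
  forall s t : 'I_n, (s < t)%N -> (i s < i t)%O.

(* Only the part of the sequence indexed by [J] is considered. *)
Definition indiscernible (L : language) (M : structure L) (A : set M)
    (d : Order.disp_t) (I : orderType d) (J : set I) (p : nat)
    (a : I -> 'I_p -> M) : Prop :=
  forall (n : nat) (i j : 'I_n -> I),
    (forall s, J (i s)) -> (forall s, J (j s)) ->
    increasing_tuple i -> increasing_tuple j ->
    forall phi : formula L ('I_n * 'I_p + A),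
      sat phi (vsum (fun x => a (i x.1) x.2) set_val) <->
      sat phi (vsum (fun x => a (j x.1) x.2) set_val).

Definition no_endpoints (d : Order.disp_t) (I : orderType d) (J : set I) : Prop :=
  forall i, J i -> (exists2 j, J j & (j < i)%O) /\ (exists2 j, J j & (i < j)%O).

(* [I] is I_1 + (c) + I_2 with I_1, I_2 infinite without endpoints. *)
Definition interior_cut (d : Order.disp_t) (I : orderType d) (c : I) : Prop :=
  let I1 := [set i | (i < c)%O] in
  let I2 := [set i | (c < i)%O] in
  [/\ infinite_set I1, no_endpoints I1, infinite_set I2 & no_endpoints I2].

(* Distality of the complete theory of which [M] is a monster model. *)
Definition distal (kappa : Type) (L : language) (M : structure L) : Prop :=
  forall A : set M, small kappa A ->
  forall (d : Order.disp_t) (I : orderType d) (c : I) (p : nat)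
    (a : I -> 'I_p -> M),
    interior_cut c ->
    indiscernible set0 [set: I] a ->
    indiscernible A [set i | i != c] a ->
    indiscernible A [set: I] a.

(* Main.v *)
From HB Require Import structures.
Require Import Defs.
From mathcomp Require Import all_boot all_order all_algebra.
From mathcomp Require Import all_classical.
From mathcomp Require Import lra.

(* Let [(a_i)] be indiscernible, and indiscernible over [A] away from [c]. By
   quantifier elimination it suffices that atomic formulas cannot tell [a_c]
   from [a_i] for [i] close to [c]. In an o-minimal structure this holds because
   the final segments making up a definable subset of the line vary
   monotonically along an indiscernible sequence, so that one containing a
   parameter at all [i <> c] also contains it at [c]. The expansion is reduced
   to this case by rewriting, near [c], each term [t(a_i, b)] as an [L]-term in
   terms over the sequence and in terms avoiding [a_c]. For a subterm
   [f(g(a_i, b))], condition (ii) over the hull of the sequence without [a_c]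
   gives such an expression at one [i] next to [c]; by indiscernibility the
   other elements of the sequence involved can be moved away from [c], so that
   the same expression is correct for all [i <> c] close to [c], and condition
   (iii) extends it to [i = c]. The points close to [c] only form an order in
   which [c] is a limit from both sides, and saturation replaces it by the
   rationals before (iii) is applied. *)

Set Implicit Arguments.
Unset Strict Implicit.
Unset Printing Implicit Defensive.

Import Order.TTheory.

Local Open Scope classical_set_scope.

(** * Terms, formulas and indiscernibility by labels *)

(** The hypotheses are lopsided: without parameters the sequence is indiscernible also at [c], over
    [A] only away from [c]. Hence two kinds of terms. A [moving] term may contain the label [c] but
    no element of [A]; a [static] term may contain elements of [A], and those allowed in a
    decomposition avoid [c]. The values of finitely many moving terms, with [c] replaced by a
    running index, again form an indiscernible sequence, and the values of static terms may be added
    as parameters away from [c]. Such a sequence satisfies exactly what o-minimal distality and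
    condition (iii) ask for. A general term mixes both kinds. Separating them is immediate for
    variables and for symbols of $\mathcal L$, so the only real obstacle is $\mathfrak f$. Condition
    (ii) speaks of elementary substructures closed under $\mathfrak f$: the hull consists of the
    values of all terms of the expansion, and it is elementary because $T$ is universal and has
    quantifier elimination. *)

Section Substitution.
Context {L : language}.

Fixpoint tsubst (V W : Type) (s : V -> term L W) (t : term L V) : term L W :=
  match t with
  | tvar x => s x
  | tapp _ f args => tapp f (fun i => tsubst s (args i))
  end.

Definition lift_subst (V W : Type) (s : V -> term L W) (o : option V) :
    term L (option W) :=
  if o is Some x then tsubst (fun y => tvar (Some y)) (s x) else tvar None.

Fixpoint fsubst (V : Type) (phi : formula L V) :
    forall W : Type, (V -> term L W) -> formula L W :=
  match phi with
  | feq t u => fun (W : Type) s => feq (tsubst s t) (tsubst s u)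
  | Defs.frel _ r args => fun (W : Type) s => Defs.frel r (fun i => tsubst s (args i))
  | fbot => fun (W : Type) s => fbot
  | fimp phi1 phi2 => fun (W : Type) s => fimp (fsubst phi1 s) (fsubst phi2 s)
  | fall psi => fun (W : Type) s => fall (fsubst psi (lift_subst s))
  end.

Fixpoint tvars (V : Type) (P : V -> Prop) (t : term L V) : Prop :=
  match t with
  | tvar x => P x
  | tapp _ f args => forall i, tvars P (args i)
  end.

Fixpoint fvars (V : Type) (phi : formula L V) : (V -> Prop) -> Prop :=
  match phi with
  | feq t u => fun P => tvars P t /\ tvars P u
  | Defs.frel _ r args => fun P => forall i, tvars P (args i)
  | fbot => fun P => True
  | fimp phi1 phi2 => fun P => fvars phi1 P /\ fvars phi2 P
  | fall psi => fun P => fvars psi (oapp P True)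
  end.

Lemma quantifier_free_subst (V : Type) (phi : formula L V) (W : Type)
    (s : V -> term L W) :
  quantifier_free phi -> quantifier_free (fsubst phi s).
Proof. by elim: phi W s => //= {}V p IHp q IHq W s [/IHp ? /IHq]. Qed.

Lemma tvars_sub (V : Type) (P Q : V -> Prop) (t : term L V) :
  (forall x, P x -> Q x) -> tvars P t -> tvars Q t.
Proof. by move=> PQ; elim: t => [x /PQ|n f args IH /= Pt i]//; exact: IH. Qed.

Lemma fvars_sub (V : Type) (P Q : V -> Prop) (phi : formula L V) :
  (forall x, P x -> Q x) -> fvars phi P -> fvars phi Q.
Proof.
elim: phi P Q => {V}//= [V t u|V n r args|V p IHp q IHq|V p IHp] P Q PQ.
- by move=> [? ?]; split; apply: tvars_sub PQ _.
- by move=> Pt i; apply: tvars_sub PQ _.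
- by move=> [? ?]; split; [apply: IHp PQ _|apply: IHq PQ _].
- by apply: IHp => -[].
Qed.

Lemma tvarsT (V : Type) (P : V -> Prop) (t : term L V) :
  (forall x, P x) -> tvars P t.
Proof. by move=> PT; elim: t => //= x. Qed.

Lemma fvarsT (V : Type) (P : V -> Prop) (phi : formula L V) :
  (forall x, P x) -> fvars phi P.
Proof.
elim: phi P => {V}//= [V t u|V n r args|V p IHp q IHq|V p IHp] P PT.
- by split; exact: tvarsT.
- by move=> i; exact: tvarsT.
- by split; [exact: IHp|exact: IHq].
- by apply: IHp => -[].
Qed.

Lemma tvars_subst (V W : Type) (P : V -> Prop) (Q : W -> Prop) (s : V -> term L W) t :
  (forall x, P x -> tvars Q (s x)) -> tvars P t -> tvars Q (tsubst s t).
Proof. by move=> PQ; elim: t => [x /PQ|n f args IH /= Pt i]//; exact: IH. Qed.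

Lemma fvars_subst (V : Type) (P : V -> Prop) (phi : formula L V) (W : Type)
    (Q : W -> Prop) (s : V -> term L W) :
  (forall x, P x -> tvars Q (s x)) -> fvars phi P -> fvars (fsubst phi s) Q.
Proof.
elim: phi P W Q s => {V}//= [V t u|V n r args|V p IHp q IHq|V p IHp] P W Q s PQ.
- by move=> [? ?]; split; apply: tvars_subst PQ _.
- by move=> Pt i; apply: tvars_subst PQ _.
- by move=> [? ?]; split; [apply: IHp PQ _|apply: IHq PQ _].
- apply: IHp => -[x /PQ|//] /=.
  exact: tvars_subst.
Qed.

Context {M : structure L}.

Lemma eval_eq (V : Type) (P : V -> Prop) (v w : V -> M) t :
  tvars P t -> (forall x, P x -> v x = w x) -> eval v t = eval w t.
Proof.
move=> Pt vw; elim: t Pt => [x /vw//|n f args IH /= Pt].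
by congr fun_int; apply/funext => i; apply: IH.
Qed.

Lemma sat_eq (V : Type) (P : V -> Prop) (v w : V -> M) (phi : formula L V) :
  fvars phi P -> (forall x, P x -> v x = w x) -> sat phi v <-> sat phi w.
Proof.
elim: phi P v w => {V}//= [V t u|V n r args|V p IHp q IHq|V p IHp] P v w.
- by move=> [Pt Pu] vw; rewrite (eval_eq Pt vw) (eval_eq Pu vw).
- move=> Pt vw; rewrite (_ : (fun i => _) = (fun i => eval w (args i)))//.
  by apply/funext => i; apply: eval_eq (Pt i) vw.
- move=> [Pp Pq] vw; have := IHp _ _ _ Pp vw; have := IHq _ _ _ Pq vw.
  tauto.
- move=> Pp vw; split=> H x; have := H x;
    by apply (IHp _ _ _ Pp) => -[y /vw|] //=.
Qed.

Lemma eval_subst (V W : Type) (s : V -> term L W) t (v : W -> M) :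
  eval v (tsubst s t) = eval (fun x => eval v (s x)) t.
Proof. by elim: t => //= n f args IH; congr fun_int; apply/funext. Qed.

Lemma sat_subst (V : Type) (phi : formula L V) (W : Type) (s : V -> term L W)
    (v : W -> M) :
  sat (fsubst phi s) v <-> sat phi (fun x => eval v (s x)).
Proof.
elim: phi W s v => {V}//= [V t u|V n r args|V p IHp q IHq|V p IHp] W s v.
- by rewrite !eval_subst.
- rewrite (_ : (fun i => _) = (fun i => eval (fun x => eval v (s x)) (args i)))//.
  by apply/funext => i; rewrite eval_subst.
- by have := IHp _ s v; have := IHq _ s v; tauto.
- have E x : (fun o => eval (oapp v x) (lift_subst s o)) =
             oapp (fun y => eval v (s y)) x.
    by apply/funext => -[y|]//=; rewrite eval_subst.
  by split=> H x; [rewrite -E -IHp|rewrite IHp E]; exact: H.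
Qed.

End Substitution.

Section FiniteSupport.
Context {L : language} {K : eqType}.

(** Since [lab] returns a list, one support lemma serves twice: with [label] it bounds the indices
    of the sequence that occur, parameters carrying none, and with [lab x] equal to [[:: x]] it
    bounds the variables themselves. *)
Definition labels_in (V : Type) (lab : V -> seq K) (l : seq K) (x : V) : Prop :=
  {subset lab x <= l}.

Lemma labels_in_sub (V : Type) (lab : V -> seq K) (l l' : seq K) x :
  {subset l <= l'} -> labels_in lab l x -> labels_in lab l' x.
Proof. by move=> ll' lx k /lx/ll'. Qed.

Lemma family_support n (P : 'I_n -> seq K -> Prop) :
  (forall i (l l' : seq K), {subset l <= l'} -> P i l -> P i l') ->
  (forall i, exists l, P i l) -> exists l, forall i, P i l.
Proof.
move=> mono /choice[l Pl]; exists (flatten [seq l i | i <- enum 'I_n]) => i.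
apply: mono (Pl i) => k kl; apply/flatten_mapP.
by exists i => //; rewrite mem_enum.
Qed.

Lemma term_support (V : Type) (lab : V -> seq K) (t : term L V) :
  exists l, tvars (labels_in lab l) t.
Proof.
elim: t => [x|n f args IH]; first by exists (lab x) => k.
apply: family_support IH => i l l' ll'.
by apply: tvars_sub => x; exact: labels_in_sub.
Qed.

Lemma formula_support (V : Type) (lab : V -> seq K) (phi : formula L V) :
  exists l, fvars phi (labels_in lab l).
Proof.
elim: phi lab => {V}//= [V t u|V n r args|V|V p IHp q IHq|V p IHp] lab.
- have [l lt] := term_support lab t; have [l' lu] := term_support lab u.
  exists (l ++ l'); split; [apply: tvars_sub lt|apply: tvars_sub lu] => x;
    by apply: labels_in_sub => k; rewrite mem_cat => ->//; rewrite orbT.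
- apply: family_support (fun i => term_support lab (args i)) => i l l' ll'.
  by apply: tvars_sub => x; exact: labels_in_sub.
- by exists [::].
- have [l lp] := IHp lab; have [l' lq] := IHq lab.
  exists (l ++ l'); split; [apply: fvars_sub lp|apply: fvars_sub lq] => x;
    by apply: labels_in_sub => k; rewrite mem_cat => ->//; rewrite orbT.
- have [l lp] := IHp (oapp lab [::]); exists l.
  by apply: fvars_sub lp => -[].
Qed.

End FiniteSupport.

(* A variable [inl (k, j)] stands for the [j]-th coordinate of the member of a
   sequence labelled [k]; a map from labels to indices places the labels. *)
Definition label {K : eqType} {P W : Type} (x : K * P + W) : seq K :=
  if x is inl (k, _) then [:: k] else [::].

Section Indiscernible.
Context {L : language} {M : structure L}.

Lemma indiscernible_subset (A B : set M) d (I : orderType d) (J : set I) p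
    (a : I -> 'I_p -> M) :
  A `<=` B -> indiscernible B J a -> indiscernible A J a.
Proof.
move=> AB inda n i j Ji Jj inci incj phi.
have AB' (x : A) : set_val x \in B by apply/mem_set/AB/set_mem/(valP x).
pose s (v : 'I_n * 'I_p + A) : term L ('I_n * 'I_p + B) :=
  match v with
  | inl x => tvar (inl x)
  | inr x => tvar (inr (exist (fun z => z \in B) _ (AB' x)))
  end.
have E (i0 : 'I_n -> I) :
   sat (fsubst phi s) (vsum (fun x => a (i0 x.1) x.2) set_val) <->
   sat phi (vsum (fun x => a (i0 x.1) x.2) set_val).
  rewrite sat_subst (_ : (fun x => _) = vsum (fun x => a (i0 x.1) x.2) set_val)//.
  by apply/funext => -[].
by rewrite -!E; exact: inda.
Qed.

(** Indiscernibility is defined by increasing tuples only; here labels come in any order and may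
    share a place. The occupied places are sorted without repetition and one label is kept for each.
    The label [k0] makes this tuple nonempty and is the default value, so callers add a label such
    as [lo] to a list that may be empty. *)
Lemma indiscernible_labels (A : set M) d (I : orderType d) (J : set I) p
    (a : I -> 'I_p -> M) (K : eqType) (W : Type) (e : W -> M)
    (phi : formula L (K * 'I_p + W)) (k0 : K) (l : seq K) (f g : K -> I) :
  indiscernible A J a -> (forall w, A (e w)) ->
  fvars phi (labels_in label l) -> k0 \in l ->
  {in l, forall k, J (f k)} -> {in l, forall k, J (g k)} ->
  {in l &, forall x y, (f x < f y)%O = (g x < g y)%O} ->
  sat phi (vsum (fun x => a (f x.1) x.2) e) <->
  sat phi (vsum (fun x => a (g x.1) x.2) e).
Proof.
move=> inda Ae phil k0l Jf Jg fg.
have fg_eq x y : x \in l -> y \in l -> (f x == f y) = (g x == g y).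
  move=> xl yl; have := fg _ _ xl yl; have := fg _ _ yl xl.
  by case: (ltgtP (f x) (f y)); case: (ltgtP (g x) (g y)).
(* [r x] is the first label of [l] that [f] puts at [x]. By [fg_eq] labels sharing a place under [f]
   share one under [g], so the same representatives serve for [g]. *)
pose r (x : I) : K := nth k0 l (index x (map f l)).
have rl x : x \in map f l -> r x \in l.
  by move=> xl; apply: mem_nth; rewrite -(size_map f) index_mem.
have rK x : x \in map f l -> f (r x) = x.
  move=> xl; rewrite /r -(nth_map _ (f k0)) ?nth_index//.
  by rewrite -(size_map f) index_mem.
pose s := sort <=%O (undup (map f l)).
have mem_s x : (x \in s) = (x \in map f l) by rewrite mem_sort mem_undup.
pose l1 := map r s.
have l1l k : k \in l1 -> k \in l.
  by move=> /mapP[x]; rewrite mem_s => /rl ? ->.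
have sort1 : sorted (relpre f <%O) l1.
  rewrite sorted_map (@eq_in_sorted _ (mem s) _ <%O).
  - by rewrite sort_lt_sorted undup_uniq.
  - by move=> x y xs ys; rewrite /= !rK// -mem_s.
  - exact/allP.
have sort2 : sorted (relpre g <%O) l1.
  have l1_all : all (mem l) l1 by apply/allP => k /l1l.
  rewrite -(@eq_in_sorted _ (mem l) (relpre f <%O) _ _ _ l1_all)//.
have n_gt0 : (0 < size l1)%N.
  rewrite size_map -has_predT; apply/hasP; exists (f k0) => //.
  by rewrite mem_s map_f.
set n := size l1 in n_gt0 *.
pose i0 : 'I_n := Ordinal n_gt0.
pose rank k : 'I_n := insubd i0 (index (r (f k)) l1).
have rankP k : k \in l -> f (nth k0 l1 (rank k)) = f k.
  move=> kl; have rkl1 : r (f k) \in l1 by rewrite map_f// mem_s map_f.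
  have lt_n : (index (r (f k)) l1 < n)%N by rewrite index_mem.
  by rewrite /rank val_insubd lt_n nth_index ?rK ?map_f// mem_s map_f.
have nl1 (i : 'I_n) : nth k0 l1 i \in l by apply: l1l; rewrite mem_nth.
have Aw w : e w \in (A : set M) by exact: mem_set.
pose sg (v : K * 'I_p + W) : term L ('I_n * 'I_p + A) :=
  match v with
  | inl x => tvar (inl (rank x.1, x.2))
  | inr w => tvar (inr (exist (fun z => z \in A) _ (Aw w)))
  end.
have E (h : K -> I) : {in l, forall k, h (nth k0 l1 (rank k)) = h k} ->
   sat (fsubst phi sg) (vsum
     (fun x : 'I_n * 'I_p => a (h (nth k0 l1 x.1)) x.2) set_val) <->
   sat phi (vsum (fun x => a (h x.1) x.2) e).
  move=> hK; rewrite sat_subst.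
  apply: (sat_eq phil) => -[[k j]|w] //= kl.
  by rewrite hK// kl// mem_head.
rewrite -!E.
- apply: (inda n (fun s1 => f (nth k0 l1 s1)) (fun s1 => g (nth k0 l1 s1)))
    => [s1|s1|s1 s2 lt12|s1 s2 lt12].
  + exact/Jf/nl1.
  + exact/Jg/nl1.
  + apply: (sorted_ltn_nth (leT := relpre f <%O)) => //; last exact: ltn_ord.
      by move=> ? ? ?; exact: lt_trans.
    exact: ltn_ord.
  + apply: (sorted_ltn_nth (leT := relpre g <%O)) => //; last exact: ltn_ord.
      by move=> ? ? ?; exact: lt_trans.
    exact: ltn_ord.
- by move=> k kl; apply/eqP; rewrite -fg_eq ?rankP ?nl1.
- by move=> k kl; exact: rankP.
Qed.

End Indiscernible.

(** * Intervals around the cut *)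

Section Gap.
Context {d : Order.disp_t} {I : orderType d}.
Local Open Scope order_scope.

Definition gap (lo hi : I) : Type := {i : I | lo < i < hi}.

HB.instance Definition _ (lo hi : I) := Choice.on (gap lo hi).
HB.instance Definition _ (lo hi : I) := SubType.on (gap lo hi).
HB.instance Definition _ (lo hi : I) :=
  [SubChoice_isSubOrder of gap lo hi by <: with d].

(* Unlike [interior_cut], this is inherited by the intervals around [c]: there
   the points below [c] may have a least element. *)
Record two_sided_limit (c : I) : Prop := TwoSidedLimit {
  limit_below : exists i, i < c;
  limit_above : exists i, c < i;
  limit_from_below : forall x, x < c -> exists2 y, x < y & y < c;
  limit_from_above : forall x, c < x -> exists2 y, c < y & y < x
}.

Lemma interior_cut_limit (c : I) : interior_cut c -> two_sided_limit c.
Proof.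
case=> inf1 no1 inf2 no2; split.
- by have [i] := infinite_setN0 inf1; exists i.
- by have [i] := infinite_setN0 inf2; exists i.
- by move=> x /no1[_ [y]]; exists y.
- by move=> x /no2[[y]]; exists y.
Qed.

(** This is what allows [c] to be exchanged for any other point of the gap without changing the
    order type of [l]. *)
Definition off_gap (c lo hi : I) (l : seq I) : Prop :=
  {in l, forall h, h != c -> (h <= lo) || (hi <= h)}.

Lemma off_gap_exists (c : I) (l : seq I) : two_sided_limit c ->
  exists lo hi, lo < c < hi /\ off_gap c lo hi l.
Proof.
move=> cut; elim: l => [|x l [lo [hi [/andP[lo_c c_hi] offl]]]].
  have [lo lo_c] := limit_below cut; have [hi c_hi] := limit_above cut.
  by exists lo, hi; rewrite lo_c.
exists (if x < c then Order.max lo x else lo).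
exists (if c < x then Order.min hi x else hi); split.
  case: (ltgtP x c) => xc; rewrite ?gt_max ?lt_min ?lo_c ?c_hi ?xc//.
move=> h; rewrite inE => /predU1P[->{h}|hl] hc.
  by move: hc; case: ltgtP => //= _; rewrite ?le_max ?ge_min lexx !orbT.
have /orP[hlo|hih] := offl h hl hc.
  by case: ifP; rewrite ?le_max hlo.
by apply/orP; right; case: ifP; rewrite ?ge_min hih.
Qed.

Lemma off_gap_bounds (c lo hi : I) (l : seq I) (x : I) :
  lo < c < hi -> off_gap c lo hi l -> x \in l ->
  (x < c -> x <= lo) /\ (c < x -> hi <= x).
Proof.
move=> /andP[lo_c c_hi] offl xl; split=> xc.
  have /orP[//|hi_x] := offl x xl (negbT (lt_eqF xc)).
  by have := lt_trans (lt_le_trans c_hi hi_x) xc; rewrite ltxx.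
have /orP[x_lo|//] := offl x xl (negbT (gt_eqF xc)).
by have := lt_trans (le_lt_trans x_lo lo_c) xc; rewrite ltxx.
Qed.

Lemma off_gap_exists_in (c lo hi : I) (l : seq I) :
  two_sided_limit c -> lo < c < hi ->
  exists lo' hi',
    [/\ lo <= lo', lo' < c < hi', hi' <= hi & off_gap c lo' hi' l].
Proof.
move=> cut /andP[lo_c c_hi].
(* With [lo] and [hi] in the list, the new gap avoids them and so lies inside the old one. *)
have [lo' [hi' [c_gap offl]]] := off_gap_exists [:: lo, hi & l] cut.
exists lo', hi'; split=> //.
- by apply: (off_gap_bounds c_gap offl _).1 => //; exact: mem_head.
- by apply: (off_gap_bounds c_gap offl _).2 => //; rewrite !inE eqxx orbT.
- by move=> h hl; apply: offl; rewrite !inE hl !orbT.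
Qed.

Lemma gap_ltl (lo hi h i j : I) : (h <= lo) || (hi <= h) ->
  lo < i < hi -> lo < j < hi -> (h < i) = (h < j).
Proof.
move=> /orP[h_lo|hi_h] /andP[lo_i i_hi] /andP[lo_j j_hi].
  by rewrite !(le_lt_trans h_lo).
by rewrite !(lt_gtF (lt_le_trans _ hi_h)).
Qed.

Lemma gap_ltr (lo hi h i j : I) : (h <= lo) || (hi <= h) ->
  lo < i < hi -> lo < j < hi -> (i < h) = (j < h).
Proof.
move=> /orP[h_lo|hi_h] /andP[lo_i i_hi] /andP[lo_j j_hi].
  by rewrite !(lt_gtF (le_lt_trans h_lo _)).
by rewrite !(lt_le_trans _ hi_h).
Qed.

End Gap.

Section GapOrder.
Context {d : Order.disp_t} {I : orderType d}.
Local Open Scope order_scope.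

Lemma gap_limit (c lo hi : I) (c_gap : lo < c < hi) : two_sided_limit c ->
  two_sided_limit (exist _ c c_gap : gap lo hi).
Proof.
move=> cut; have /andP[lo_c c_hi] := c_gap.
pose mk i (i_gap : lo < i < hi) : gap lo hi := exist _ i i_gap.
have below x : lo <= x -> x < c -> exists2 y : gap lo hi, x < val y & val y < c.
  move=> lo_x /(limit_from_below cut)[y xy yc].
  have y_gap : lo < y < hi by rewrite (le_lt_trans lo_x) ?(lt_trans yc).
  by exists (mk y y_gap).
have above x : x <= hi -> c < x -> exists2 y : gap lo hi, c < val y & val y < x.
  move=> x_hi /(limit_from_above cut)[y cy yx].
  have y_gap : lo < y < hi by rewrite (lt_trans lo_c) ?(lt_le_trans yx).
  by exists (mk y y_gap).
split.
- by have [y _ yc] := below lo (lexx _) lo_c; exists y.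
- by have [y cy _] := above hi (lexx _) c_hi; exists y.
- by move=> x xc; have /andP[/ltW lo_x _] := valP x; exact: below.
- by move=> x xc; have /andP[_ /ltW x_hi] := valP x; exact: above.
Qed.

Definition moved (c i x : I) : I := if x == c then i else x.

Lemma moved_id (c x : I) : moved c c x = x.
Proof. by rewrite /moved; case: eqP. Qed.

End GapOrder.

Section Derived.
Context {L : language} {M : structure L} {A : set M}.
Context {d : Order.disp_t} {I : orderType d} {p : nat} (a : I -> 'I_p -> M).

Definition pure_val (f : I -> I) (x : I * 'I_p) : M := a (f x.1) x.2.

Definition base_val : I * 'I_p + A -> M := vsum (pure_val id) set_val.

(** Substituting the terms turns a formula about the new sequence into one about [a], with labels in
    ['I_n + I]: running indices on the left, fixed labels on the right. The fixed ones lie outside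
    the gap, so any two increasing tuples in the gap are placed alike among them. The point [lo] is
    the spare label for [indiscernible_labels]. *)
Lemma derived_indiscernible (J : set I) (c lo hi : I) (m : nat) (W : Type)
    (X : 'I_m -> term L (I * 'I_p)) (E : W -> term L (I * 'I_p + A))
    (l : seq I) :
  indiscernible A J a -> (lo < c < hi)%O -> J lo ->
  off_gap c lo hi l -> {in l, forall h, h != c -> J h} ->
  (forall j, tvars (fun x => x.1 \in l) (X j)) ->
  (forall w, tvars (labels_in label [seq h <- l | h != c]) (E w)) ->
  indiscernible (range (fun w => eval base_val (E w)))
    [set i : gap lo hi | J (val i)]
    (fun i j => eval (pure_val (moved c (val i))) (X j)).
Proof.
move=> inda c_gap Jlo offl Jl Xl El n i j Ji Jj inci incj phi.
have /choice[w wE] (x : range (fun w => eval base_val (E w))) :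
    exists w, eval base_val (E w) = set_val x.
  by case: (set_mem (valP x)) => w _ wE; exists w; exact: wE.
pose sX (s : 'I_n) (x : I * 'I_p) : term L (('I_n + I) * 'I_p + A) :=
  tvar (inl (if x.1 == c then inl s else inr x.1, x.2)).
pose sE (x : I * 'I_p + A) : term L (('I_n + I) * 'I_p + A) :=
  match x with inl y => tvar (inl (inr y.1, y.2)) | inr z => tvar (inr z) end.
pose s (v : 'I_n * 'I_m + range (fun w => eval base_val (E w))) :=
  match v with
  | inl x => tsubst (sX x.1) (X x.2)
  | inr y => tsubst sE (E (w y))
  end.
pose l' : seq ('I_n + I) := [seq inl s | s <- enum 'I_n] ++
  [seq inr h | h <- lo :: [seq h <- l | h != c]].
pose f (i : 'I_n -> gap lo hi) (k : 'I_n + I) : I :=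
  match k with inl s => val (i s) | inr h => h end.
have satE (i0 : 'I_n -> gap lo hi) :
    sat (fsubst phi s) (vsum (fun x => a (f i0 x.1) x.2) set_val) <->
    sat phi (vsum (fun x : 'I_n * 'I_m =>
      eval (pure_val (moved c (val (i0 x.1)))) (X x.2)) set_val).
  rewrite sat_subst (_ : (fun x => _) = vsum (fun x : 'I_n * 'I_m =>
      eval (pure_val (moved c (val (i0 x.1)))) (X x.2)) set_val)//.
  apply/funext => -[[s0 j0]|y] /=; rewrite eval_subst.
    congr (eval _ _); apply/funext => -[h q] /=.
    by rewrite /pure_val /moved /=; case: eqP.
  rewrite -wE; congr (eval _ _).
  by apply/funext => -[].
have l'J (i0 : 'I_n -> gap lo hi) : (forall s, J (val (i0 s))) ->
    {in l', forall k, J (f i0 k)}.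
  move=> Ji0 k; rewrite mem_cat => /orP[/mapP[s0 _ ->]|/mapP[h + ->]].
    exact: Ji0.
  by rewrite inE =>  /predU1P[->//|]; rewrite mem_filter => /andP[hc hl]; exact: Jl.
have offl' h : h \in lo :: [seq h <- l | h != c] -> (h <= lo)%O || (hi <= h)%O.
  rewrite inE mem_filter => /predU1P[->|/andP[hc hl]]; first by rewrite lexx.
  exact: offl.
rewrite -!satE.
apply: (indiscernible_labels (k0 := inr lo) (l := l') inda).
- by move=> x; exact/set_mem/(valP x).
- apply: (fvars_subst (P := fun=> True)); last first.
    exact: fvarsT.
  move=> [[s0 j0]|y] _ /=.
    apply: tvars_subst (Xl j0) => -[h q] /= hl k; rewrite mem_seq1 => /eqP ->{k}.
    rewrite mem_cat; case: eqP => hc; first by rewrite map_f// mem_enum.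
    by rewrite map_f ?orbT// inE mem_filter hl orbC; case: eqP hc.
  apply: tvars_subst (El (w y)) => -[[h q]|z] //= hl k; rewrite mem_seq1 => /eqP ->{k}.
  by rewrite mem_cat map_f ?orbT// inE hl ?orbT// mem_head.
- by rewrite mem_cat map_f ?orbT// mem_head.
- exact: l'J.
- exact: l'J.
- have lt_tuple (i0 : 'I_n -> gap lo hi) s0 s1 : increasing_tuple i0 ->
      (val (i0 s0) < val (i0 s1))%O = (s0 < s1)%N.
    move=> inc0; case: (ltngtP s0 s1) => [/inc0//|/inc0|/val_inj->].
      by move=> /lt_gtF.
    by rewrite ltxx.
  have l'P k : k \in l' -> (exists s0, k = inl s0) \/
      exists2 h, k = inr h & (h <= lo)%O || (hi <= h)%O.
    rewrite mem_cat => /orP[/mapP[s0 _ ->]|/mapP[h /offl' hl ->]].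
      by left; exists s0.
    by right; exists h.
  move=> _ _ /l'P[[s0 ->]|[h -> hl]] /l'P[[s1 ->]|[h' -> h'l]] //=.
  + by rewrite !lt_tuple.
  + exact: (gap_ltr h'l (valP (i s0)) (valP (j s0))).
  + exact: (gap_ltl hl (valP (i s1)) (valP (j s1))).
Qed.

End Derived.

(** * Distality of o-minimal structures *)

Section Connectives.
Context {L : language}.

Definition fneg (V : Type) (p : formula L V) : formula L V := fimp p fbot.
Definition fand (V : Type) (p q : formula L V) : formula L V :=
  fneg (fimp p (fneg q)).
Definition fex (V : Type) (p : formula L (option V)) : formula L V :=
  fneg (fall (fneg p)).
Definition flt (S : oag_symbols L) (V : Type) (t u : term L V) : formula L V :=
  Defs.frel (sym_lt S) (args2 t u).

Lemma fvars_fand (V : Type) (p q : formula L V) P :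
  fvars p P -> fvars q P -> fvars (fand p q) P.
Proof. by do !split. Qed.

Context {M : structure L}.

Lemma sat_and (V : Type) (p q : formula L V) (v : V -> M) :
  sat (fand p q) v <-> sat p v /\ sat q v.
Proof. rewrite /=; have := EM (sat p v); have := EM (sat q v); tauto. Qed.

Lemma sat_ex (V : Type) (p : formula L (option V)) (v : V -> M) :
  sat (fex p) v <-> exists x, sat p (oapp v x).
Proof.
split=> [/existsNP[x /contrapT px]|[x px] /(_ x)]; first by exists x.
exact.
Qed.

Lemma sat_lt (S : oag_symbols L) (V : Type) (t u : term L V) (v : V -> M) :
  sat (flt S t u) v <-> lt_int S (eval v t) (eval v u).
Proof.
rewrite /lt_int /= (_ : (fun i => _) = args2 (eval v t) (eval v u))//.
by apply/funext => -[[|[|]]].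
Qed.

End Connectives.

Section LocalIndiscernibility.
Context {L : language} {M : structure L} {A : set M}.
Context {d : Order.disp_t} {I : orderType d} {p : nat} (a : I -> 'I_p -> M).

(** In a tuple passing through [c], a nearby point can take the place of [c]. After this change any
    two tuples avoid [c] and are compared by the indiscernibility there. *)
Lemma indiscernible_of_local (c : I) : two_sided_limit c ->
  indiscernible A [set i | i != c] a ->
  (forall psi : formula L (I * 'I_p + A), exists lo hi,
     (lo < c < hi)%O /\ forall i, (lo < i < hi)%O ->
       sat psi (vsum (pure_val a (moved c i)) set_val) <->
       sat psi (base_val a)) ->
  indiscernible A [set: I] a.
Proof.
move=> cut inda loc n.
suff off (i : 'I_n -> I) (phi : formula L ('I_n * 'I_p + A)) :
    increasing_tuple i ->
    exists2 i' : 'I_n -> I, (forall s, i' s != c) /\ increasing_tuple i' &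
    sat phi (vsum (fun x => a (i x.1) x.2) set_val) <->
    sat phi (vsum (fun x => a (i' x.1) x.2) set_val).
  move=> i j _ _ inci incj phi.
  have [i' [i'c inci'] ->] := off i phi inci.
  have [j' [j'c incj'] ->] := off j phi incj.
  exact: inda.
move=> inci.
pose ren (x : 'I_n * 'I_p + A) : term L (I * 'I_p + A) :=
  tvar (match x with inl y => inl (i y.1, y.2) | inr z => inr z end).
have [lo [hi [c_gap loc_phi]]] := loc (fsubst phi ren).
(* The other entries of [i] are kept out of this gap, so a point of it can replace [c] and the tuple
   stays increasing. *)
have [lo' [hi' [lo_lo' c_gap' hi'_hi offi]]] :=
  off_gap_exists_in (codom i) cut c_gap.
have /andP[lo'_c c_hi'] := c_gap'.
have [x lo'_x x_c] := limit_from_below cut lo'_c.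
have x_gap' : (lo' < x < hi')%O by rewrite lo'_x (lt_trans x_c).
have x_gap : (lo < x < hi)%O.
  by rewrite (le_lt_trans lo_lo')//= (lt_le_trans _ hi'_hi)// (lt_trans x_c).
exists (moved c x \o i).
  split=> [s|s t st] /=; rewrite /moved.
    by case: (eqVneq (i s) c) => // _; rewrite lt_eqF.
  have := inci _ _ st.
  have off_i u : i u != c -> (i u <= lo')%O || (hi' <= i u)%O.
    by apply: offi; exact: codom_f.
  case: eqVneq => [->|isc]; case: eqVneq => [->|itc] //.
  - by rewrite ltxx.
  - by rewrite -(gap_ltr (off_i _ itc) x_gap' c_gap').
  - by rewrite -(gap_ltl (off_i _ isc) x_gap' c_gap').
have := loc_phi x x_gap; rewrite !sat_subst => loc_x.
rewrite (_ : vsum (fun x => a (i x.1) x.2) set_val =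
  fun x => eval (base_val a) (ren x)); last by apply/funext => -[].
by rewrite -loc_x /=; apply: (sat_eq (fvarsT (P := xpredT) phi _)) => // -[].
Qed.

End LocalIndiscernibility.

Section OMinimalDistality.
Context {L : language} (S : oag_symbols L) {N : structure L}.
Context (N_oag : ordered_abelian_group S N).

Local Notation "x <o y" := (lt_int S (M := N) x y) (at level 70).

(* [alternations X k y]: there are [z_1 <= ... <= z_k <= y] lying alternately
   inside and outside [X], starting inside. For an o-minimal structure the
   largest such [k] is finite, and its parity decides whether [y] is in [X]; as
   these sets are upward closed, this reduces definable sets to final segments. *)
Fixpoint alternations (X : set N) (k : nat) (y : N) : Prop :=
  if k is k'.+1 then
    exists z, [/\ ~ y <o z, alternations X k' z & X z <-> odd k]
  else True.

Lemma nlt_trans (x y z : N) : ~ y <o x -> ~ z <o y -> ~ z <o x.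
Proof.
move=> yx zy zx; case: (oag_total N_oag x y) => [xy|xy|//].
- by apply: zy; exact: (oag_trans N_oag zx).
- by apply: zy; rewrite -xy.
Qed.

Lemma alternations_up X k y y' :
  ~ y' <o y -> alternations X k y -> alternations X k y'.
Proof.
case: k => //= k yy' [z [zy zk Xz]]; exists z; split=> //.
exact: nlt_trans zy yy'.
Qed.

(** Upward closed subsets of a line form a chain. *)
Lemma alternations_total X Y k :
  alternations X k `<=` alternations Y k \/ alternations Y k `<=` alternations X k.
Proof.
have [|/existsNP[x /not_implyP[Xx Yx]]] :=
  EM (alternations X k `<=` alternations Y k); first by left.
right=> y Yy; apply: alternations_up Xx => yx; apply: Yx.
apply: alternations_up Yy => xy.
by apply: (oag_irr N_oag) (oag_trans N_oag xy yx).
Qed.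

(** If $k$ is the largest length available at $y$, then $y$ itself cannot be appended as a further
    point, and this decides its membership by the parity of $k$. *)
Lemma alternations_parity X Y y : (exists k, ~ alternations X k y) ->
  (forall k, alternations X k y <-> alternations Y k y) -> X y <-> Y y.
Proof.
move=> [k0 Xk0] XY.
have mem Z k : alternations Z k y -> ~ alternations Z k.+1 y -> Z y <-> odd k.
  move=> Zk Zk1; split=> [Zy|].
    apply/negP => /negP Nk; apply: Zk1; exists y.
    by split; [exact: oag_irr|by []|rewrite /= Nk].
  apply: contraPP => nZy k_odd; apply: Zk1; exists y.
  by split; [exact: oag_irr|by []|rewrite /= k_odd].
have [k Xk Xk1] : exists2 k, alternations X k y & ~ alternations X k.+1 y.
  elim: k0 Xk0 => [[]//|k IH Xk1].
  by have [/IH//|/contrapT] := EM (~ alternations X k y); exists k.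
by rewrite (mem X k)// (mem Y k)// -XY.
Qed.

Definition order_convex (C : set N) : Prop :=
  forall x y z, C x -> C z -> ~ y <o x -> ~ z <o y -> C y.

Lemma alternations_seq X k y : alternations X k y ->
  exists2 s : nat -> N, forall j, (0 < j <= k)%N -> (X (s j) <-> odd j) &
    (forall j, (0 < j < k)%N -> ~ s j.+1 <o s j) /\ ((0 < k)%N -> ~ y <o s k).
Proof.
elim: k y => [|k IH] y.
  by exists (fun=> y) => [[]|]//; split=> // j; rewrite ltn0 andbF.
case=> z [zy /IH[s Xs [s_mono s_z]] Xz].
exists (fun j => if (j <= k)%N then s j else z) => [j /andP[j0]|] /=.
  rewrite leq_eqVlt => /predU1P[->|]; first by rewrite ltnn.
  by rewrite ltnS => jk; rewrite jk; apply: Xs; rewrite j0.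
split=> [j /andP[j0]|]; last by rewrite /= ltnn.
rewrite ltnS => jk; have [->|jk'] : j = k \/ (j < k)%N.
    by apply/predU1P; rewrite -leq_eqVlt.
  by rewrite leqnn ltnn; apply: s_z; rewrite (leq_trans j0).
by rewrite jk jk'; apply: s_mono; rewrite j0.
Qed.

(** The $n+1$ witnesses of odd number lie in $X$, so two of them share a convex piece. The even
    witness following the first of the two lies between them and would belong to $X$ as well. *)
Lemma alternations_bounded X n (C : 'I_n -> set N) y :
  (forall j, order_convex (C j)) -> X = \bigcup_j C j ->
  ~ alternations X n.*2.+1 y.
Proof.
move=> Cconv XC /alternations_seq[s Xs [s_mono _]].
have mono i j : (0 < i)%N -> (i + j <= n.*2.+1)%N -> ~ s (i + j)%N <o s i.
  move=> i0; elim: j => [|j IH]; first by rewrite addn0 => _; exact: oag_irr.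
  rewrite addnS => ij; apply: nlt_trans (IH (ltnW ij)) _.
  by apply: s_mono; rewrite addn_gt0 i0.
have /choice[f Cf] (t : 'I_n.+1) : exists j, C j (s t.*2.+1).
  have : X (s t.*2.+1).
    by apply/Xs; rewrite /= ?odd_double// ltnS leq_double -ltnS ltn_ord.
  by rewrite XC => -[j _]; exists j.
have [t1 [t2 [t12 ft]]] : exists t1 t2 : 'I_n.+1, (t1 < t2)%N /\ f t1 = f t2.
  have : ~~ injectiveb f.
    apply/injectiveP => /leq_card; rewrite !card_ord ltnn//.
  move=> /injectivePn[t1 [t2 t12 ft]].
  move: t12; rewrite neq_ltn => /orP[|] t12; first by exists t1, t2.
  by exists t2, t1.
have t2n : (t2.*2.+1 <= n.*2.+1)%N by rewrite ltnS leq_double -ltnS ltn_ord.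
have t12' : (t1.*2.+2 <= t2.*2.+1)%N.
  by rewrite ltnS (leq_trans _ (_ : t1.+1.*2 <= _)%N) ?leq_double.
have Xt1 : X (s t1.*2.+2).
  rewrite XC; exists (f t1) => //.
  apply: Cconv (Cf t1) _ _ _; first by rewrite ft; exact: Cf.
    by rewrite -addn1; apply: mono; rewrite // addn1 (leq_trans t12').
  by rewrite -(subnKC t12'); apply: mono; rewrite // subnKC.
have t1n : (0 < t1.*2.+2 <= n.*2.+1)%N by rewrite (leq_trans t12').
by have := (Xs _ t1n).1 Xt1; rewrite /= odd_double.
Qed.

Lemma o_minimal_alternations (V : Type) (chi : formula L (option V))
    (v : V -> N) y : o_minimal S N ->
  exists k, ~ alternations [set z | sat chi (oapp v z)] k y.
Proof.
move=> omin.
pose s (o : option V) : term L (unit + N) :=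
  tvar (if o is Some x then inr (v x) else inl tt).
have [n [k [q [lo [hi E]]]]] := omin (fsubst chi s).
pose C (j : 'I_(n + k)) : set N := match fintype.split j with
  | inl i => [set q i] | inr i => open_interval S (lo i) (hi i) end.
exists (n + k).*2.+1; apply: (@alternations_bounded _ _ C).
  move=> j x z w; rewrite /C; case: (fintype.split j) => i.
    move=> -> -> zq qz; case: (oag_total N_oag z (q i)) => //.
  move=> [lo_x _] [_ w_hi] zx wz; split.
    case: (lo i) lo_x => // r rx; case: (oag_total N_oag x z) => [xz|<-//|//].
    exact: (oag_trans N_oag rx).
  case: (hi i) w_hi => // r wr; case: (oag_total N_oag z w) => [zw|->//|//].
  exact: (oag_trans N_oag zw).
have satE z : sat (fsubst chi s) (vsum (fun=> z) id) <-> sat chi (oapp v z).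
  rewrite sat_subst (_ : (fun x => _) = oapp v z)//.
  by apply/funext => -[].
apply/seteqP; split=> z.
  move=> /satE; rewrite -[sat _ _]/([set x : N | sat (fsubst chi s)
    (vsum (fun=> x) id)] z) E => -[[i _ <-]|[i _ iz]].
    by exists (lshift k i); rewrite // /C (unsplitK (inl i)).
  by exists (rshift n i); rewrite // /C (unsplitK (inr i)).
move=> [j _ Cj] /=; apply/satE.
rewrite -[sat _ _]/([set x : N | sat (fsubst chi s) (vsum (fun=> x) id)] z) E.
move: Cj; rewrite /C; case: (fintype.split j) => i; first by move=> ->; left; exists i.
by right; exists i.
Qed.

Section AlternationFormula.
Context {V : Type} (chi : formula L (option V)).

(** Inside a further quantifier [None] is the new point and [Some None] the old one; the renaming
    makes [p] speak of the new point and passes over the old. *)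
Definition under_binder (p : formula L (option V)) :
    formula L (option (option V)) :=
  fsubst p (fun o => tvar (omap Some o)).

(** With the final segments first order, indiscernibility applies both to membership in one of them
    and to inclusion between two. *)
Fixpoint alternation_formula (k : nat) : formula L (option V) :=
  if k is k'.+1 then
    fex (fand (fneg (flt S (tvar (Some None)) (tvar None)))
      (fand (under_binder (alternation_formula k'))
        (if odd k then under_binder chi else fneg (under_binder chi))))
  else fimp fbot fbot.

Lemma fvars_alternation (P : option V -> Prop) k :
  P None -> fvars chi P -> fvars (alternation_formula k) P.
Proof.
move=> P0 chiP; elim: k => [//|k IH].
have ub q : fvars q P -> fvars (under_binder q) (oapp P True).
  by apply: fvars_subst => -[].
have lt_vars : fvars (flt S (tvar (Some None)) (tvar None)) (oapp P True).
  by case=> -[|[|]].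
split=> //; split=> //; apply: fvars_fand => //; apply: fvars_fand; first exact: ub.
by case: ifP => _; [|split=> //]; exact: ub.
Qed.

Lemma sat_alternation k (v : V -> N) y :
  sat (alternation_formula k) (oapp v y) <->
  alternations [set z | sat chi (oapp v z)] k y.
Proof.
have ub p (x z : N) : sat (under_binder p) (oapp (oapp v x) z) <-> sat p (oapp v z).
  rewrite sat_subst (_ : (fun x => _) = oapp v z)//.
  by apply/funext => -[].
elim: k y => [|k IH] y; first by split=> _; [|move=> []].
have E z : sat (fand (fneg (flt S (tvar (Some None)) (tvar None)))
      (fand (under_binder (alternation_formula k))
        (if odd k.+1 then under_binder chi else fneg (under_binder chi))))
      (oapp (oapp v y) z) <->
    [/\ ~ y <o z, alternations [set z | sat chi (oapp v z)] k z &
       sat chi (oapp v z) <-> odd k.+1].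
  rewrite !sat_and ub IH.
  rewrite -[sat (fneg _) _]/(~ sat (flt S _ _) _) sat_lt.
  have [T F] : true /\ ~ (false : Prop) by [].
  have := ub chi y z; case: (odd k.+1) => /= ubz.
    by split=> [[? [? ?]]|[? ? ?]]; split; tauto.
  by split=> [[? [? ?]]|[? ? ?]]; split; tauto.
by rewrite -[alternation_formula k.+1]/(fex _) sat_ex; split=> -[z /E]; exists z.
Qed.

End AlternationFormula.

End OMinimalDistality.

Section MovedLabels.
Context {d : Order.disp_t} {I : orderType d}.
Local Open Scope order_scope.

Lemma moved_lt (c lo hi i j : I) (l : seq I) : off_gap c lo hi l ->
  lo < i < hi -> lo < j < hi ->
  {in lo :: l &, forall x y,
    (moved c i x < moved c i y) = (moved c j x < moved c j y)}.
Proof.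
move=> offl i_gap j_gap.
have off' h : h \in lo :: l -> h != c -> (h <= lo) || (hi <= h).
  by rewrite inE => /predU1P[->|/offl//]; rewrite lexx.
move=> x y xl yl; rewrite /moved.
case: eqVneq => [_|xc]; case: eqVneq => [_|yc] //.
- by rewrite !ltxx.
- exact: gap_ltr (off' _ yl yc) i_gap j_gap.
- exact: gap_ltl (off' _ xl xc) i_gap j_gap.
Qed.

End MovedLabels.

Section OMinimalDistal.
Context {L : language} (S : oag_symbols L) {N : structure L}.
Context (N_oag : ordered_abelian_group S N) (N_omin : o_minimal S N).
Context {d : Order.disp_t} {I : orderType d} {p : nat} (a : I -> 'I_p -> N).
Context (c : I) (cut : two_sided_limit c).

Lemma o_minimal_distal_point (E : set N) (y : N) :
  indiscernible E [set: I] a ->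
  indiscernible (E `|` [set y]) [set i | i != c] a ->
  indiscernible (E `|` [set y]) [set: I] a.
Proof.
move=> indE indEy; apply: (indiscernible_of_local cut) => // psi.
have /choice[g gE] (w : E `|` [set y]) :
    exists o : option E, oapp set_val y o = set_val w.
  case: (set_mem (valP w)) => [Ew|wy]; last by exists None; exact: esym wy.
  by exists (Some (exist (fun z => z \in E) _ (mem_set Ew))).
pose s (x : I * 'I_p + (E `|` [set y])) : term L (option (I * 'I_p + E)) :=
  tvar (match x with inl u => Some (inl u) | inr w => omap inr (g w) end).
pose chi := fsubst psi s.
pose v f : I * 'I_p + E -> N := vsum (pure_val a f) set_val.
have sat_chi f :
    sat chi (oapp (v f) y) <-> sat psi (vsum (pure_val a f) set_val).
  rewrite sat_subst (_ : (fun x => _) = vsum (pure_val a f) set_val)//.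
  by apply/funext => -[//|w] /=; rewrite -gE; case: (g w).
pose lab : option (I * 'I_p + E) -> seq I := oapp label [::].
have [l chil] := formula_support lab chi.
have [lo [hi [c_gap offl]]] := off_gap_exists l cut.
exists lo, hi; split=> // i0 i0_gap.
pose X i := [set z | sat chi (oapp (v (moved c i)) z)].
have satX k i z :
    sat (alternation_formula S chi k) (oapp (v (moved c i)) z) <->
    alternations S (X i) k z.
  exact: sat_alternation.
have alt_l k : fvars (alternation_formula S chi k) (labels_in lab l).
  exact: fvars_alternation.
(* Membership of [y] uses the parameter [y], so it is known to be constant only away from [c]. *)
have off_c k i j : (lo < i < hi)%O -> (lo < j < hi)%O -> i != c -> j != c ->
    alternations S (X i) k y <-> alternations S (X j) k y.
  move=> i_gap j_gap ic jc.
  pose r (o : option (I * 'I_p + E)) : term L (I * 'I_p + option E) :=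
    tvar (match o with
          | None => inr None
          | Some (inl u) => inl u
          | Some (inr w) => inr (Some w)
          end).
  pose F := fsubst (alternation_formula S chi k) r.
  have satF f : sat F (vsum (fun x => a (f x.1) x.2) (oapp set_val y)) <->
      sat (alternation_formula S chi k) (oapp (v f) y).
    rewrite sat_subst (_ : (fun x => _) = oapp (v f) y)//.
    by apply/funext => -[[]|].
  rewrite -!satX -!satF.
  apply: (indiscernible_labels (k0 := lo) (l := lo :: l) indEy).
  - by move=> [w|] /=; [left; exact/set_mem/(valP w)|right].
  - apply: fvars_subst (alt_l k) => -[[[h q]|w]|] //= hl h'.
    by move=> /hl; rewrite inE => ->; rewrite orbT.
  - exact: mem_head.
  - by move=> h _ /=; rewrite /moved; case: (eqVneq h c).
  - by move=> h _ /=; rewrite /moved; case: (eqVneq h c).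
  - exact: moved_lt offl i_gap j_gap.
(* Inclusion does not mention [y], so indiscernibility over [E] transports it, also to pairs that
   contain [c]. *)
have sub_shift k i i' j j' : (lo < i < hi)%O -> (lo < i' < hi)%O ->
    (lo < j < hi)%O -> (lo < j' < hi)%O -> (i < i')%O -> (j < j')%O ->
    alternations S (X i) k `<=` alternations S (X i') k ->
    alternations S (X j) k `<=` alternations S (X j') k.
  move=> i_gap i'_gap j_gap j'_gap ii' jj'.
  pose r1 (o : option (I * 'I_p + E)) :
      term L (option (option I * 'I_p + E)) :=
    tvar (omap (fun u => match u with
      inl (x, q) => inl (Some x, q) | inr w => inr w end) o).
  (* Two copies of the moving point are needed in one formula: [Some c] is placed at [i] and [None]
     at [i']. *)
  pose r2 (o : option (I * 'I_p + E)) :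
      term L (option (option I * 'I_p + E)) :=
    tvar (omap (fun u => match u with
      | inl (x, q) => inl (if x == c then None else Some x, q)
      | inr w => inr w end) o).
  pose F := fall (fimp (fsubst (alternation_formula S chi k) r1)
                       (fsubst (alternation_formula S chi k) r2)).
  pose f i i' (o : option I) := if o is Some x then moved c i x else i'.
  have satF j1 j2 :
      sat F (vsum (fun x => a (f j1 j2 x.1) x.2) set_val) <->
      alternations S (X j1) k `<=` alternations S (X j2) k.
    have E1 z : sat (fsubst (alternation_formula S chi k) r1)
        (oapp (vsum (fun x => a (f j1 j2 x.1) x.2) set_val) z) <->
        alternations S (X j1) k z.
      rewrite sat_subst -satX.
      rewrite (_ : (fun x => _) = oapp (v (moved c j1)) z)//.
      by apply/funext => -[[[]|]|].
    have E2 z : sat (fsubst (alternation_formula S chi k) r2)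
        (oapp (vsum (fun x => a (f j1 j2 x.1) x.2) set_val) z) <->
        alternations S (X j2) k z.
      rewrite sat_subst -satX.
      rewrite (_ : (fun x => _) = oapp (v (moved c j2)) z)//.
      apply/funext => -[[[x q]|]|] //=.
      by rewrite /f /pure_val /moved /=; case: (eqVneq x c) => // /negbTE ->.
    split=> [H z Xz|H z]; first by apply/E2/(H z)/E1.
    by move=> /E1/H Xz; apply/E2.
  rewrite -!satF.
  suff -> : sat F (vsum (fun x => a (f i i' x.1) x.2) set_val) <->
    sat F (vsum (fun x => a (f j j' x.1) x.2) set_val) by [].
  have lt_None h : h \in lo :: l -> h != c -> (h <= lo)%O || (hi <= h)%O.
    by rewrite inE => /predU1P[->|/offl//]; rewrite lexx.
  apply: (indiscernible_labels (k0 := None)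
    (l := None :: [seq Some h | h <- lo :: l]) indE) => //.
  - by move=> w; exact/set_mem/(valP w).
  - have mem_l h q : labels_in lab l (Some (inl (h, q))) ->
        Some h \in None :: [seq Some h | h <- lo :: l].
      by move=> /(_ h (mem_head _ _)) hl; rewrite !in_cons map_f ?orbT.
    split; apply: fvars_subst (alt_l k) => -[[[h q]|w]|] // /mem_l hl h';
      rewrite mem_seq1 => /eqP -> //.
    by case: eqP => _; rewrite ?mem_head.
  - have memP o : o \in None :: [seq Some h | h <- lo :: l] ->
        o = None \/ exists2 h, h \in lo :: l & o = Some h.
      by rewrite in_cons => /predU1P[->|/mapP]; [left|right].
    move=> _ _ /memP[->|[h hl ->]] /memP[->|[h' h'l ->]] /=.
    + by rewrite !ltxx.
    + rewrite /moved; case: eqVneq => [_|h'c].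
        by rewrite (lt_gtF ii') (lt_gtF jj').
      exact: gap_ltr (lt_None _ h'l h'c) i'_gap j'_gap.
    + rewrite /moved; case: eqVneq => [_|hc]; first by rewrite ii' jj'.
      exact: gap_ltl (lt_None _ hl hc) i'_gap j'_gap.
    + exact: moved_lt offl i_gap j_gap _ _ hl h'l.
have /andP[lo_c c_hi] := c_gap.
have [i1 lo_i1 i1_c] := limit_from_below cut lo_c.
have [i2 c_i2 i2_hi] := limit_from_above cut c_hi.
have i1_gap : (lo < i1 < hi)%O by rewrite lo_i1 (lt_trans i1_c).
have i2_gap : (lo < i2 < hi)%O by rewrite i2_hi (lt_trans lo_c).
have alt_c k i : (lo < i < hi)%O ->
    alternations S (X i) k y <-> alternations S (X c) k y.
  move=> i_gap; case: (eqVneq i c) => [->//|ic].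
  rewrite (off_c k _ _ i_gap i1_gap ic) ?lt_eqF//.
  have i12 := off_c k _ _ i1_gap i2_gap (negbT (lt_eqF i1_c)) (negbT (gt_eqF c_i2)).
  (* If the segments grow with the index, the one at [c] lies between those at [i1] and [i2], which
     agree about [y]; otherwise they shrink and the same squeeze works. *)
  have [s1c|] := EM (alternations S (X i1) k `<=` alternations S (X c) k).
    split=> [/s1c//|yc]; apply/i12.
    exact: (sub_shift k i1 c c i2 i1_gap c_gap c_gap i2_gap i1_c c_i2 s1c).
  move=> ns1c.
  have sc1 : alternations S (X c) k `<=` alternations S (X i1) k.
    by have [/ns1c|] := alternations_total N_oag (X i1) (X c) k.
  have s2c : alternations S (X i2) k `<=` alternations S (X c) k.
    have [//|sc2] := alternations_total N_oag (X i2) (X c) k.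
    case: ns1c.
    exact: (sub_shift k c i2 i1 c c_gap i2_gap i1_gap c_gap c_i2 i1_c sc2).
  by split=> [/i12/s2c//|/sc1].
rewrite -sat_chi.
have -> : base_val a = vsum (pure_val a (moved c c)) (@set_val _ (E `|` [set y])).
  rewrite /base_val; congr (vsum _ _).
  by apply/funext => x; rewrite /pure_val moved_id.
rewrite -sat_chi.
apply: (alternations_parity (X := X i0) (Y := X c) N_oag).
  exact: o_minimal_alternations.
by move=> k; exact: alt_c.
Qed.

(** Parameters are adjoined one at a time: full indiscernibility over those already adjoined is the
    hypothesis [indE] for the next one. *)
Lemma o_minimal_distal (k : nat) (b : 'I_k -> N) :
  indiscernible set0 [set: I] a ->
  indiscernible (range b) [set i | i != c] a ->
  indiscernible (range b) [set: I] a.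
Proof.
move=> ind0 indb.
suff H j : (j <= k)%N -> indiscernible (b @` [set i : 'I_k | (i < j)%N]) [set: I] a.
  apply: indiscernible_subset (H k (leqnn k)) => _ [i _ <-].
  by exists i => //=; exact: ltn_ord.
elim: j => [_|j IH jk].
  by apply: indiscernible_subset ind0 => x [i].
have bE : b @` [set i : 'I_k | (i < j.+1)%N] =
    b @` [set i : 'I_k | (i < j)%N] `|` [set b (Ordinal jk)].
  apply/seteqP; split=> x.
    move=> [i /= ij <-]; have [E|ij'] : i = j :> nat \/ (i < j)%N.
        by apply/predU1P; rewrite -leq_eqVlt.
      by right; congr b; apply/val_inj.
    by left; exists i.
  move=> [[i /= ij <-]|->]; last by exists (Ordinal jk) => //=.
  by exists i => //=; rewrite ltnS ltnW.
rewrite bE; apply: o_minimal_distal_point; first exact/IH/ltnW.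
rewrite -bE; apply: indiscernible_subset indb => x [i _ <-].
by exists i.
Qed.

End OMinimalDistal.

(** * Saturation and sequences indexed by the rationals *)

Lemma ltn_count (T : eqType) (P Q : pred T) (l : seq T) (x : T) :
  subpred P Q -> x \in l -> Q x -> ~~ P x -> (count P l < count Q l)%N.
Proof.
move=> PQ + Qx Px; elim: l => //= y l IH.
rewrite inE => /predU1P[<-|/IH lt_l].
  by rewrite Qx (negbTE Px) add0n add1n ltnS sub_count.
by rewrite -addnS leq_add//; case: (boolP (P y)) => // /PQ ->.
Qed.

Section SqueezedEmbeddings.
Context {d : Order.disp_t} {I : orderType d} (c : I) (cut : two_sided_limit c).
Context {d' : Order.disp_t} {Q : orderType d'} (l : seq Q).
Local Open Scope order_scope.

(** Near [c] the order may be as thin as an increasing sequence, [c], and a decreasing sequence, so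
    monotonicity is asked only on the finite list [l]. The bound [hi'] leaves free room between [c]
    and the image, which a moving point can use later. *)
Lemma squeeze_above (hi : I) : c < hi ->
  exists2 hi', c < hi' & exists2 g : Q -> I, forall x, hi' <= g x < hi &
    {in l &, forall x y, x < y -> g x < g y}.
Proof.
move=> c_hi.
have /choice[f fP] (x : I) : exists y, c < x -> c < y < x.
  have [/(limit_from_above cut)[y cy yx]|_] := ltP c x; last by exists x.
  by exists y; rewrite cy.
pose s n := iter n f hi.
have cs n : c < s n by elim: n => //= n IH; have /andP[] := fP _ IH.
have sS n : s n.+1 < s n by have /andP[] := fP _ (cs n).
have s_lt m n : (m < n)%N -> s n < s m.
  elim: n => // n IH; rewrite ltnS leq_eqVlt => /predU1P[->|/IH]; first exact: sS.
  exact/lt_trans/sS.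
have s_le m n : (m <= n)%N -> s n <= s m.
  by rewrite leq_eqVlt => /predU1P[->//|/s_lt/ltW].
exists (s (size l).+1) => //.
(* [s] is decreasing, so [x] is placed by the number of entries of [l] not below it. The successor
   keeps the value strictly below [s 0], which is [hi]; the count is at most [size l]. *)
exists (fun x => s (count (fun y => x <= y) l).+1) => [x|x y xl yl xy].
  by rewrite s_le ?ltnS ?count_size// -[X in _ < X]/(s 0%N) s_lt.
apply: s_lt; rewrite ltnS; apply: (@ltn_count _ _ _ _ x) => //.
  by move=> z /=; exact/le_trans/ltW.
by rewrite -ltNge.
Qed.

Lemma squeeze_below : exists g : Q -> I, (forall x, g x < c) /\
    {in l &, forall x y, x < y -> g x < g y}.
Proof.
have [lo lo_c] := limit_below cut.
have /choice[f fP] (x : I) : exists y, x < c -> x < y < c.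
  have [/(limit_from_below cut)[y cy yx]|_] := ltP x c; last by exists x.
  by exists y; rewrite cy.
pose s n := iter n f lo.
have cs n : s n < c by elim: n => //= n IH; have /andP[] := fP _ IH.
have s_lt m n : (m < n)%N -> s m < s n.
  have sS k : s k < s k.+1 by have /andP[] := fP _ (cs k).
  elim: n => // n IH; rewrite ltnS leq_eqVlt => /predU1P[->|/IH]; first exact: sS.
  by move=> /lt_trans; apply.
exists (fun x => s (count (fun y => y <= x) l)); split=> // x y xl yl xy.
apply: s_lt; apply: (@ltn_count _ _ _ _ y) => //.
  by move=> z /= zx; exact: le_trans zx (ltW xy).
by rewrite -ltNge.
Qed.

End SqueezedEmbeddings.

Section LimitEmbedding.
Context {d : Order.disp_t} {I : orderType d} (c : I) (cut : two_sided_limit c).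
Context {d' : Order.disp_t} {Q : orderType d'} (q0 : Q).
Local Open Scope order_scope.

Lemma limit_embedding (l : seq Q) : exists2 f : Q -> I, f q0 = c &
  {in q0 :: l &, forall x y, x < y -> f x < f y}.
Proof.
have [hi c_hi] := limit_above cut.
have [hi' c_hi' [g hi'_g g_mono]] := squeeze_above cut (q0 :: l) c_hi.
have [g' [g'_c g'_mono]] := squeeze_below cut (q0 :: l).
have cg x : c < g x by have /andP[+ _] := hi'_g x; exact: lt_le_trans.
exists (fun x => if x < q0 then g' x else if q0 < x then g x else c).
  by rewrite ltxx.
move=> x y xl yl xy.
case: (ltgtP x q0) (xy) => [x_q0|q0_x|->].
- move=> _; case: (ltgtP y q0) => // _; first exact: g'_mono.
  exact: lt_trans (g'_c x) (cg y).
- by move=> /(lt_trans q0_x) q0_y; rewrite (lt_gtF q0_y) q0_y; exact: g_mono.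
- by move=> q0_y; rewrite (lt_gtF q0_y) q0_y.
Qed.

End LimitEmbedding.

Definition eventually_true (P : nat -> Prop) : Prop :=
  exists N, forall k, (N <= k)%N -> P k.

Lemma eventually_and (P Q : nat -> Prop) : eventually_true P ->
  eventually_true Q -> eventually_true (fun k => P k /\ Q k).
Proof.
move=> [m mP] [n nQ]; exists (maxn m n) => k.
by rewrite geq_max => /andP[/mP ? /nQ].
Qed.

Lemma eventually_imp (P Q : nat -> Prop) : (forall k, P k -> Q k) ->
  eventually_true P -> eventually_true Q.
Proof. by move=> PQ [m mP]; exists m => k /mP/PQ. Qed.

Section Saturation.
Context {L : language} {kappa : Type} {M : structure L}.
Context (large : small kappa [set: formula L nat]) (M_sat : saturated kappa M).

(** [kappa] is infinite since it dominates the set of formulas in countably many variables, which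
    contains infinitely many equations of a variable with itself. *)
Lemma finite_small (A : set M) : finite_set A -> small kappa A.
Proof.
move=> finA.
have inf_formula : infinite_set [set: formula L nat].
  move=> fin; apply: infinite_nat.
  apply: sub_finite_set
    (finite_preimage (f := fun n => feq (tvar n) (tvar n)) _ fin) => //.
  by move=> m n _ _ [].
have inf_kappa : infinite_set [set: kappa].
  by move=> /(card_le_finite large.1).
split; last by move=> /card_le_finite/(_ finA).
exact/(card_le_trans (finite_set_countable finA))/infiniteP.
Qed.

(** Closure under conjunction lets one formula of [p] imply any given finite part of [p]; [phi0]
    takes care of the empty part. *)
Lemma realize_type (W : Type) (e : W -> M) (p : set (formula L (option W))) :
  finite_set (range e) -> p !=set0 ->
  (forall phi psi, p phi -> p psi -> p (fand phi psi)) ->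
  (forall phi, p phi -> exists x, sat phi (oapp e x)) ->
  exists x, forall phi, p phi -> sat phi (oapp e x).
Proof.
move=> fin_e [phi0 p0] p_and p_sat.
have er w : e w \in range e by apply/mem_set; exists w.
pose s (o : option W) : term L ('I_1 + range e) :=
  tvar (if o is Some w then inr (exist (fun x => x \in range e) _ (er w))
        else inl ord0).
have satE phi (x : 'I_1 -> M) :
    sat (fsubst phi s) (vsum x set_val) <-> sat phi (oapp e (x ord0)).
  rewrite sat_subst (_ : (fun x => _) = oapp e (x ord0))//.
  by apply/funext => -[].
have [|x xP] := M_sat (finite_small fin_e) (p := [set fsubst phi s | phi in p]).
  move=> q /(@finite_seqP {classic _})[r ->] rp.
  have [phi [p_phi phi_r]] : exists phi, p phi /\ forall theta, theta \in r ->
      forall x, sat phi (oapp e x) -> sat theta (vsum (fun=> x) set_val).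
    elim: r rp => [|theta r IH] rp; first by exists phi0.
    have [phi [p_phi phi_r]] : exists phi, p phi /\ forall theta, theta \in r ->
        forall x, sat phi (oapp e x) -> sat theta (vsum (fun=> x) set_val).
      by apply: IH => u ur; apply: rp; rewrite /= inE ur orbT.
    have [|psi p_psi psiE] := rp theta; first exact: mem_head.
    exists (fand phi psi); split; first exact: p_and.
    move=> u + x /sat_and[phi_x psi_x]; rewrite inE => /predU1P[->|ur].
      by rewrite -psiE satE.
    exact: phi_r.
  have [x phi_x] := p_sat _ p_phi; exists (fun=> x) => theta theta_r.
  exact: phi_r.
exists (x ord0) => phi p_phi; rewrite -satE; apply: xP.
by exists phi.
Qed.

End Saturation.

Section CountableTypes.
Context {L : language} {kappa : Type} {M : structure L}.
Context (large : small kappa [set: formula L nat]) (M_sat : saturated kappa M).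

(** Saturation handles finitely many variables, so a type in countably many is realized one
    coordinate at a time. The type at stage [n] is consistent: if $\phi$ holds eventually, so does
    $\exists x\,\phi$, and [good n] makes the coordinates already chosen satisfy the latter. *)
Lemma realize_eventual (W : Type) (e : W -> M) (v : nat -> nat -> M) :
  finite_set (range e) ->
  exists y : nat -> M, forall psi : formula L (nat + W),
    eventually_true (fun k => sat psi (vsum (v k) e)) -> sat psi (vsum y e).
Proof.
move=> fin_e.
pose below n (x : nat + W) : Prop := if x is inl m then (m < n)%N else True.
pose good n (y : nat -> M) := forall psi : formula L (nat + W),
  fvars psi (below n) ->
  eventually_true (fun k => sat psi (vsum (v k) e)) -> sat psi (vsum y e).
have step n y : exists x, good n y -> good n.+1 (fun m => if m == n then x else y m).
  have [gn|ngn] := EM (good n y); last first.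
    by case: (dom_inhabited M) => x; exists x => /ngn.
  pose e' z : 'I_n + W -> M := vsum (fun i : 'I_n => z (i : nat)) e.
  pose p := [set phi : formula L (option ('I_n + W)) |
    eventually_true (fun k => sat phi (oapp (e' (v k)) (v k n)))].
  have [|||phi p_phi|x xP] := @realize_type _ _ _ large M_sat _ (e' y) p.
  - have -> : range (e' y) = range (fun i : 'I_n => y i) `|` range e.
      apply/seteqP; split=> z.
        by move=> [[i|w] _ <-]; [left; exists i|right; exists w].
      by move=> [[i _ <-]|[w _ <-]]; [exists (inl i)|exists (inr w)].
    by rewrite finite_setU; split=> //; exact: finite_image.
  - by exists (fimp fbot fbot); exists 0 => k _ [].
  - move=> phi psi p_phi p_psi; apply: eventually_imp (eventually_and p_phi p_psi).
    by move=> k; rewrite sat_and.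
  - pose s (x : 'I_n + W) : term L (nat + W) :=
      tvar (match x with inl i => inl (i : nat) | inr w => inr w end).
    have satE z : sat (fsubst (fex phi) s) (vsum z e) <->
        exists x, sat phi (oapp (e' z) x).
      rewrite sat_subst sat_ex (_ : (fun x => _) = e' z)//.
      by apply/funext => -[].
    apply/satE/gn.
      apply: (fvars_subst (P := fun=> True)); last exact: fvarsT.
      by move=> [i|//] _; exact: ltn_ord.
    by apply: eventually_imp p_phi => k sat_k; apply/satE; exists (v k n).
  exists x => _ psi psi_n psi_ev.
  pose s (x : nat + W) : term L (option ('I_n + W)) :=
    tvar (match x with inl m => omap inl (insub m) | inr w => Some (inr w) end).
  have satE z x' : sat (fsubst psi s) (oapp (e' z) x') <->
      sat psi (vsum (fun m => if m == n then x' else z m) e).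
    rewrite sat_subst; apply: (sat_eq psi_n) => -[m|//] /=.
    rewrite ltnS leq_eqVlt => /predU1P[->|mn]; first by rewrite eqxx insubF ?ltnn.
    by rewrite insubT/= ltn_eqF.
  apply/satE/xP; apply: eventually_imp psi_ev => k sat_k; apply/satE.
  rewrite (_ : (fun m => _) = v k)//.
  by apply/funext => m; case: eqP => // ->.
have /choice[f fP] (z : nat * (nat -> M)) := step z.1 z.2.
have [m0] := dom_inhabited M.
pose Y := fix Y n : nat -> M :=
  if n is n'.+1 then fun m => if m == n' then f (n', Y n') else Y n' m
  else fun=> m0.
have goodY n : good n (Y n).
  elim: n => [psi psi0 [k /(_ k (leqnn k))]|n IH]; last exact: (fP (n, Y n)) IH.
  by apply (sat_eq psi0) => -[].
(* Coordinate [m] is settled from stage [m.+1] on, so the diagonal agrees with every stage on the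
   coordinates chosen by then. *)
have Y_stable m n : (m < n)%N -> Y n m = Y m.+1 m.
  elim: n => // n IH; rewrite ltnS leq_eqVlt => /predU1P[->//|mn].
  by rewrite -(IH mn)/= ltn_eqF.
exists (fun m => Y m.+1 m) => psi psi_ev.
have [l psi_l] := formula_support (fun x : nat + W =>
  if x is inl m then [:: m] else [::]) psi.
pose n := (\max_(m <- l) m).+1.
have psi_n : fvars psi (below n).
  apply: fvars_sub psi_l => -[m|//] /(_ m (mem_head _ _)) ml.
  by rewrite /= ltnS; exact: (bigmaxn_sup_seq m).
apply: (sat_eq psi_n _).1 (goodY n psi psi_n psi_ev) => -[m|//] /=.
exact: Y_stable.
Qed.

Context {d : Order.disp_t} {I : orderType d} (c : I) (cut : two_sided_limit c).
Context {m : nat} (a : I -> 'I_m -> M).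

(* Each condition concerns finitely many rationals, and these can be embedded
   in [I] near [c]; so the conditions are finitely satisfiable. *)
Lemma rational_sequence (W : Type) (e : W -> M) : finite_set (range e) ->
  exists2 y : rat -> 'I_m -> M, y 0%R = a c &
  forall (psi : formula L (rat * 'I_m + W)) (l : seq rat),
    (forall f : rat -> I, f 0%R = c ->
      {in 0%R :: l &, forall q r, (q < r)%O -> (f q < f r)%O} ->
      sat psi (vsum (fun x => a (f x.1) x.2) e)) ->
    sat psi (vsum (fun x => y x.1 x.2) e).
Proof.
move=> fin_e.
(* The coordinates of [a c] become parameters, so that the equality of [y 0] with [a c] is itself an
   eventually true formula. *)
pose e' : W + 'I_m -> M := vsum e (a c).
have fin_e' : finite_set (range e').
  have -> : range e' = range e `|` range (a c).
    apply/seteqP; split=> z.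
      by move=> [[w|j] _ <-]; [left; exists w|right; exists j].
    by move=> [[w _ <-]|[j _ <-]]; [exists (inl w)|exists (inr j)].
  by rewrite finite_setU; split=> //; exact: finite_image.
(* The rationals with code below [k]; every finite list of rationals is eventually included. *)
pose lk k : seq rat := pmap unpickle (iota 0 k).
have /choice[f fP] k : exists f : rat -> I, f 0%R = c /\
    {in 0%R :: lk k &, forall q r, (q < r)%O -> (f q < f r)%O}.
  by have [f] := limit_embedding cut 0%R (lk k); exists f.
have [x0] := dom_inhabited M.
pose v k n : M := if unpickle n is Some x then a (f k x.1) x.2 else x0.
have [y yP] := realize_eventual v fin_e'.
pose s (x : rat * 'I_m + W) : term L (nat + (W + 'I_m)) :=
  tvar (match x with inl z => inl (pickle z) | inr w => inr (inl w) end).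
have main (psi : formula L (rat * 'I_m + W)) (l : seq rat) :
    (forall f : rat -> I, f 0%R = c ->
      {in 0%R :: l &, forall q r, (q < r)%O -> (f q < f r)%O} ->
      sat psi (vsum (fun x => a (f x.1) x.2) e)) ->
    sat psi (vsum (fun x => y (pickle x)) e).
  move=> psi_f.
  have : sat (fsubst psi s) (vsum y e').
    apply: yP; exists (\max_(q <- l) pickle q).+1 => k l_k.
    rewrite sat_subst (_ : (fun x => _) = vsum (fun x => a (f k x.1) x.2) e).
      have [f0 f_mono] := fP k; apply: psi_f => // q r ql rl.
      have lP x : x \in 0%R :: l -> x \in 0%R :: lk k.
        rewrite !inE => /predU1P[->|xl]; first by rewrite eqxx.
        rewrite mem_pmap; apply/orP; right; apply/mapP.
        exists (pickle x); last by rewrite pickleK.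
        rewrite mem_iota add0n (leq_ltn_trans _ l_k)//.
        exact: (bigmaxn_sup_seq x).
      by apply: f_mono; exact: lP.
    by apply/funext => -[[q j]|w] //=; rewrite /v pickleK.
  rewrite sat_subst (_ : (fun x => _) = vsum (fun x => y (pickle x)) e)//.
  by apply/funext => -[].
exists (fun q j => y (pickle (q, j))).
  apply/funext => j.
  have : sat (feq (tvar (inl (pickle (0%R : rat, j)))) (tvar (inr (inr j)))
    : formula L (nat + (W + 'I_m))) (vsum y e').
    by apply: yP; exists 0 => k _; rewrite /= /v pickleK/= (fP k).1.
  by [].
move=> psi l /main; rewrite (_ : (fun x => y (pickle x)) =
  (fun x => y (pickle (x.1, x.2))))//.
Qed.

End CountableTypes.

Lemma no_endpoints_infinite d (I : orderType d) (J : set I) :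
  J !=set0 -> no_endpoints J -> infinite_set J.
Proof.
move=> J0 Jno /finite_seqP[s Js].
have maxP (r : seq I) : r != [::] ->
    exists2 m, m \in r & {in r, forall x, (x <= m)%O}.
  elim: r => // x [|y r] IH _.
    by exists x; rewrite ?mem_head// => z; rewrite inE => /eqP ->.
  have [//|m mr rm] := IH; have [xm|mx] := leP x m.
    exists m; first by rewrite inE mr orbT.
    by move=> z; rewrite inE => /predU1P[->//|/rm].
  exists x; first exact: mem_head.
  by move=> z; rewrite inE => /predU1P[->//|/rm/le_trans]; apply; exact: ltW.
have s0 : s != [::] by case: J0 => x; rewrite Js; case: (s).
have [m ms sm] := maxP _ s0.
have [|_ [x]] := Jno m; first by rewrite Js.
by rewrite Js /= => /sm; rewrite leNgt => /negP.
Qed.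

Lemma interior_cut_rat : interior_cut (0%R : rat).
Proof.
have no1 : no_endpoints [set q : rat | (q < 0%R)%O].
  move=> q /= q0; split; [exists (q - 1)%R|exists (q / 2%:R)%R] => /=; lra.
have no2 : no_endpoints [set q : rat | (0%R < q)%O].
  move=> q /= q0; split; [exists (q / 2%:R)%R|exists (q + 1)%R] => /=; lra.
split=> //; apply: no_endpoints_infinite => //.
- by exists (-1)%R.
- by exists 1%R.
Qed.

(** * The reduct to $\mathcal L$, and condition (iii) at a two-sided limit *)

Section Reduct.
Context {L : language}.

Fixpoint tlift (V : Type) (t : term L V) : term (expand L) V :=
  match t with
  | tvar x => tvar x
  | tapp _ f args =>
      @tapp (expand L) V _ (old_sym f) (fun i => tlift (args i))
  end.

Fixpoint flift (V : Type) (phi : formula L V) : formula (expand L) V :=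
  match phi with
  | feq t u => feq (tlift t) (tlift u)
  | Defs.frel n r args => @Defs.frel (expand L) V n r (fun i => tlift (args i))
  | fbot => fbot
  | fimp p q => fimp (flift p) (flift q)
  | fall p => fall (flift p)
  end.

Definition tnew (V : Type) (t : term (expand L) V) : term (expand L) V :=
  @tapp (expand L) V 1 (@new_sym L) (fun=> t).

Context {M : structure (expand L)}.

Lemma eval_lift (V : Type) (t : term L V) (v : V -> M) :
  eval v (tlift t) = @eval L (reduct M) V v t.
Proof. by elim: t => //= n f args IH; congr fun_int; apply/funext. Qed.

Lemma sat_lift (V : Type) (phi : formula L V) (v : V -> M) :
  sat (flift phi) v <-> @sat L (reduct M) V phi v.
Proof.
elim: phi v => {V}//= [V t u|V n r args|V p IHp q IHq|V p IHp] v.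
- by rewrite !eval_lift.
- rewrite (_ : (fun i => _) = (fun i => @eval L (reduct M) V v (args i)))//.
  by apply/funext => i; rewrite eval_lift.
- by have := IHp v; have := IHq v; tauto.
- by split=> H x; apply/IHp/H.
Qed.

Lemma indiscernible_reduct (A : set M) d (I : orderType d) (J : set I) p
    (a : I -> 'I_p -> M) :
  indiscernible A J a -> @indiscernible L (reduct M) A d I J p a.
Proof.
move=> inda n i j Ji Jj inci incj phi.
by rewrite -!sat_lift; exact: inda.
Qed.

End Reduct.

(** Condition (iii) with the requirement on the cut left open as [P], so that it can be extended
    from [interior_cut] to [two_sided_limit]. *)
Definition preserves_equations (L : language) (M : structure (expand L))
    (P : forall (disp : Order.disp_t) (I : orderType disp), I -> Prop) : Prop :=
  forall (n m k l : nat) (le_nm : (n <= m)%N)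
    (g : term L ('I_m + 'I_k)) (h : term L ('I_n + 'I_l))
    (b1 : 'I_k -> M) (b2 : 'I_l -> M),
  (forall j, range (@new_fun L M) (b2 j)) ->
  forall (disp : Order.disp_t) (I : orderType disp) (c : I)
    (a : I -> 'I_m -> M),
  (forall i (j : 'I_n), range (@new_fun L M) (a i (widen_ord le_nm j))) ->
  P disp I c ->
  indiscernible set0 [set: I] a ->
  indiscernible (range b1 `|` range b2) [set i | i != c] a ->
  let equation (i : I) : Prop :=
    new_fun (@eval L (reduct M) _ (vsum (a i) b1) g) =
    @eval L (reduct M) _
      (vsum (fun j : 'I_n => a i (widen_ord le_nm j)) b2) h in
  (forall i, i != c -> equation i) -> equation c.

(** Indiscernibility, membership of coordinates in the range of $\mathfrak f$ and the equation away
    from [c] are families of formulas that each involve finitely many indices. They hold under every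
    order embedding of these indices that sends 0 to [c], so they pass to the rational sequence; the
    conclusion comes back because that sequence has the value [a c] at 0. *)
Lemma preserves_equations_limit (L : language) (kappa : Type)
    (M : structure (expand L)) :
  small kappa [set: formula (expand L) nat] -> saturated kappa M ->
  preserves_equations M (@interior_cut) ->
  preserves_equations M (@two_sided_limit).
Proof.
move=> large M_sat pres n m k l le_nm g h b1 b2 fb2 disp I c a fa cut ind0 indb.
move=> equation eq_off.
pose e : 'I_k + 'I_l -> M := vsum b1 b2.
have e_range : range e = range b1 `|` range b2.
  apply/seteqP; split=> z.
    by move=> [[j|j] _ <-]; [left; exists j|right; exists j].
  by move=> [[j _ <-]|[j _ <-]]; [exists (inl j)|exists (inr j)].
have [|y y0 yP] := rational_sequence large M_sat cut a (e := e).
  by rewrite e_range finite_setU; split; exact: finite_image.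
suff : new_fun (@eval L (reduct M) _ (vsum (y 0%R) b1) g) =
    @eval L (reduct M) _
      (vsum (fun j : 'I_n => y 0%R (widen_ord le_nm j)) b2) h by rewrite y0.
have y_shift (A : set M) (J : set I) (J' : set rat) : indiscernible A J a ->
    A `<=` range e ->
    (forall (f : rat -> I) q, f 0%R = c ->
      {in 0%R :: q :: [::] &, forall q r, (q < r)%O -> (f q < f r)%O} ->
      J' q -> J (f q)) ->
    indiscernible A J' y.
  move=> inda Ae JJ' u i j Ji Jj inci incj phi.
  have /choice[w wE] (x : A) : exists w, e w = set_val x.
    by have [w _] := Ae _ (set_mem (valP x)); exists w.
  pose s (i0 : 'I_u -> rat) (x : 'I_u * 'I_m + A) :
      term (expand L) (rat * 'I_m + ('I_k + 'I_l)) :=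
    tvar (match x with
          | inl z => inl (i0 z.1, z.2)
          | inr x => inr (w x)
          end).
  have satE (z : rat -> 'I_m -> M) i0 :
      sat (fsubst phi (s i0)) (vsum (fun x => z x.1 x.2) e) <->
      sat phi (vsum (fun x => z (i0 x.1) x.2) set_val).
    rewrite sat_subst (_ : (fun x => _) = vsum (fun x => z (i0 x.1) x.2) set_val)//.
    by apply/funext => -[//|x] /=; rewrite wE.
  rewrite -(satE y i) -(satE y j).
  pose F := fand (fimp (fsubst phi (s i)) (fsubst phi (s j)))
                 (fimp (fsubst phi (s j)) (fsubst phi (s i))).
  suff : sat F (vsum (fun x => y x.1 x.2) e) by move/sat_and => -[? ?].
  apply: (yP _ (codom i ++ codom j)) => f f0 f_mono.
  have f_inc (i0 : 'I_u -> rat) : {subset codom i0 <= codom i ++ codom j} ->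
      increasing_tuple i0 -> increasing_tuple (f \o i0).
    move=> sub_i0 inc0 s0 s1 /inc0; apply: f_mono;
      by rewrite inE sub_i0 ?orbT// codom_f.
  have sub_i : {subset codom i <= codom i ++ codom j}.
    by move=> x; rewrite mem_cat => ->.
  have sub_j : {subset codom j <= codom i ++ codom j}.
    by move=> x; rewrite mem_cat => ->; rewrite orbT.
  have f_J (i0 : 'I_u -> rat) : {subset codom i0 <= codom i ++ codom j} ->
      (forall s, J' (i0 s)) -> forall s, J (f (i0 s)).
    move=> sub_i0 Ji0 s0; apply: JJ' f0 _ (Ji0 s0) => q r ql rl.
    have sub x : x \in [:: 0%R; i0 s0] -> x \in 0%R :: (codom i ++ codom j).
      by rewrite !inE => /orP[->//|/eqP ->]; rewrite sub_i0 ?orbT// codom_f.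
    by apply: f_mono; exact: sub.
  have ind_ij := inda u (f \o i) (f \o j) (f_J _ sub_i Ji) (f_J _ sub_j Jj)
    (f_inc _ sub_i inci) (f_inc _ sub_j incj) phi.
  apply/sat_and; split=> /=;
    by rewrite !(satE (fun q => a (f q))) => /ind_ij.
apply: (pres n m k l le_nm g h b1 b2 fb2 _ rat 0%R y).
- move=> q j.
  suff : sat (fex (feq (tnew (tvar None))
      (tvar (Some (inl (q, widen_ord le_nm j))))))
    (vsum (fun x => y x.1 x.2) e).
    by move/sat_ex => [x fx]; exists x.
  apply: (yP _ [::]) => f _ _; apply/sat_ex.
  by have [x _ fx] := fa (f q) j; exists x.
- exact: interior_cut_rat.
- by apply: y_shift ind0 _ _.
- apply: y_shift indb _ _; first by rewrite e_range.
  move=> f q f0 f_mono /= q0; rewrite -f0.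
  case: (ltgtP q 0%R) q0 => // q0 _; [rewrite lt_eqF//|rewrite gt_eqF//];
    by apply: f_mono; rewrite ?inE ?eqxx ?orbT.
- move=> q q0.
  pose sg (x : 'I_m + 'I_k) : term (expand L) (rat * 'I_m + ('I_k + 'I_l)) :=
    tvar (match x with inl j => inl (q, j) | inr j => inr (inl j) end).
  pose sh (x : 'I_n + 'I_l) : term (expand L) (rat * 'I_m + ('I_k + 'I_l)) :=
    tvar (match x with inl j => inl (q, widen_ord le_nm j)
                     | inr j => inr (inr j) end).
  pose F := feq (tnew (tsubst sg (tlift g))) (tsubst sh (tlift h)).
  have satF (z : rat -> 'I_m -> M) : sat F (vsum (fun x => z x.1 x.2) e) <->
      new_fun (@eval L (reduct M) _ (vsum (z q) b1) g) =
      @eval L (reduct M) _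
        (vsum (fun j : 'I_n => z q (widen_ord le_nm j)) b2) h.
    rewrite [sat _ _]/= !eval_subst !eval_lift.
    rewrite (_ : (fun x => eval _ (sg x)) = vsum (z q) b1); last first.
      by apply/funext => -[].
    rewrite (_ : (fun x => eval _ (sh x)) =
      vsum (fun j : 'I_n => z q (widen_ord le_nm j)) b2)//.
    by apply/funext => -[].
  apply/satF/(yP _ [:: q]) => f f0 f_mono; apply/(satF (fun q => a (f q))).
  apply: eq_off; rewrite -f0.
  case: (ltgtP q 0%R) q0 => // q0 _; [rewrite lt_eqF//|rewrite gt_eqF//];
    by apply: f_mono; rewrite ?inE ?eqxx ?orbT.
Qed.

(** * Substructures and finitely many variables *)

Section Substructures.
Context {L : language} {M : structure L}.

Lemma eval_induced (B : substructure M) (V : Type) (t : term L V)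
    (v : V -> B) :
  set_val (@eval L (induced B) V v t) = eval (fun x => set_val (v x)) t.
Proof. by elim: t => //= n f args IH; congr fun_int; apply/funext. Qed.

Lemma sat_induced_qf (B : substructure M) (V : Type) (phi : formula L V)
    (v : V -> B) : quantifier_free phi ->
  @sat L (induced B) V phi v <-> sat phi (fun x => set_val (v x)).
Proof.
elim: phi v => {V}//= [V t u|V n r args|V p IHp q IHq] v.
- move=> _; rewrite -!eval_induced; split=> [->//|E].
  exact: val_inj.
- move=> _; rewrite (_ : (fun i => set_val _) =
    (fun i => eval (fun x => set_val (v x)) (args i)))//.
  by apply/funext => i; rewrite -eval_induced.
- by move=> [/(IHp v) ? /(IHq v)]; tauto.
Qed.

Lemma sat_induced_universal (B : substructure M) (V : Type)
    (phi : formula L V) (v : V -> B) : universal phi ->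
  sat phi (fun x => set_val (v x)) -> @sat L (induced B) V phi v.
Proof.
elim: phi v => {V} [V t u|V n r args|V|V p _ q _|V p IHp] v.
- by move=> phi_qf /sat_induced_qf; apply.
- by move=> phi_qf /sat_induced_qf; apply.
- by [].
- by move=> phi_qf /sat_induced_qf; apply.
- move=> /IHp{}IHp all_p x; apply: IHp.
  rewrite (_ : (fun o => _) = oapp (fun y => set_val (v y)) (set_val x))//.
  by apply/funext => -[].
Qed.

Lemma models_induced (T : theory L) (B : substructure M) :
  universally_axiomatizable T -> models M T -> models (induced B) T.
Proof.
move=> [U U_univ UT] /UT MU; apply/UT => s Us.
apply: sat_induced_universal; first exact: U_univ.
have := MU s Us; rewrite /holds (_ : @of_void M = fun x => set_val (of_void B x))//.
by apply/funext => -[].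
Qed.

(** Universal axioms pass to substructures, so both structures are models of [T], and quantifier
    elimination leaves only quantifier-free formulas to compare. Thus the hull of a sequence becomes
    admissible in condition (ii). *)
Lemma elementary_substructure (T : theory L) (B : substructure M) :
  universally_axiomatizable T -> quantifier_elimination T -> models M T ->
  elementary B.
Proof.
move=> T_univ T_qe MT n phi b.
have [psi psi_qf psiE] := T_qe n phi.
rewrite (psiE _ (models_induced B T_univ MT)) (psiE _ MT).
exact: sat_induced_qf.
Qed.

Lemma eval_generated (X : set M) (V : Type) (v : V -> M) (t : term L V) :
  (forall x, generated X (v x)) -> generated X (eval v t).
Proof. by move=> Xv; elim: t => //= n f args IH; exact: gen_app. Qed.

(* The constant serves as a default value when [V] is empty. *)
Lemma quantifier_free_equivalent (T : theory L) (cst : term L void)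
    (V : Type) (phi : formula L V) :
  quantifier_elimination T -> models M T ->
  exists2 psi : formula L V, quantifier_free psi &
    forall v : V -> M, sat phi v <-> sat psi v.
Proof.
move=> T_qe MT.
have [l phi_l] := formula_support (fun x : V => [:: x : {classic V}]) phi.
pose r (x : V) : 'I_(size l).+1 := inord (index (x : {classic V}) l).
have [psi psi_qf psiE] := T_qe _ (fsubst phi (fun x => tvar (r x))).
pose s (i : 'I_(size l).+1) : term L V :=
  nth (tsubst (fun x : void => match x with end) cst) [seq tvar x | x <- l] i.
exists (fsubst psi s); first exact: quantifier_free_subst.
move=> v; rewrite sat_subst -psiE // sat_subst.
apply: (sat_eq phi_l) => x /(_ x (mem_head _ _)) xl /=.
rewrite /s /r inordK ?ltnS ?index_size// (nth_map x) ?index_mem//=.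
by congr (v _); exact: esym (nth_index (x : {classic V}) xl).
Qed.

End Substructures.

Lemma tvars_and (L : language) (V : Type) (P Q : V -> Prop) (t : term L V) :
  tvars P t -> tvars Q t -> tvars (fun x => P x /\ Q x) t.
Proof.
by elim: t => //= n f args IH Pt Qt i; apply: IH.
Qed.

Lemma fvars_and (L : language) (V : Type) (P Q : V -> Prop)
    (phi : formula L V) :
  fvars phi P -> fvars phi Q -> fvars phi (fun x => P x /\ Q x).
Proof.
elim: phi P Q => {V}//= [V t u|V n r args|V p IHp q IHq|V p IHp] P Q.
- by move=> [? ?] [? ?]; split; exact: tvars_and.
- by move=> Pt Qt i; exact: tvars_and.
- by move=> [? ?] [? ?]; split; [exact: IHp|exact: IHq].
- by move=> Pp Qp; apply: fvars_sub (IHp _ _ Pp Qp) => -[x|].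
Qed.

Definition enumerate_vars (V1 V2 : Type) (m k : nat) (x1 : 'I_m -> V1)
    (x2 : 'I_k -> V2) (x : 'I_m + 'I_k) : V1 + V2 :=
  match x with inl i => inl (x1 i) | inr i => inr (x2 i) end.

Section FiniteVariables.
Context {L : language} {V1 V2 : Type} (P : V1 + V2 -> Prop).
Context (d1 : V1) (d2 : V2) (P1 : P (inl d1)) (P2 : P (inr d2)).

(** The two kinds of variables are enumerated separately because moving terms will become
    coordinates of a sequence and static terms parameters. The defaults fill vacant positions, hence
    they too have to satisfy [P]. *)
Lemma finite_renaming (l : seq {classic (V1 + V2)}) :
  exists m k (x1 : 'I_m -> V1) (x2 : 'I_k -> V2) (r : V1 + V2 -> 'I_m + 'I_k),
    (forall x, P (enumerate_vars x1 x2 x)) /\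
    forall x, P x /\ {subset [:: x : {classic (V1 + V2)}] <= l} ->
      enumerate_vars x1 x2 (r x) = x.
Proof.
pose l' : seq {classic (V1 + V2)} := [seq x <- l | `[< P x >]].
(* Both enumerations share the positions of [l']; a position held by the other kind receives the
   default. *)
pose z1 (i : 'I_(size l).+1) : V1 :=
  if nth (inl d1 : {classic (V1 + V2)}) l' i is inl x then x else d1.
pose z2 (i : 'I_(size l).+1) : V2 :=
  if nth (inr d2 : {classic (V1 + V2)}) l' i is inr x then x else d2.
pose r (x : V1 + V2) : 'I_(size l).+1 + 'I_(size l).+1 :=
  let i := inord (index (x : {classic (V1 + V2)}) l') in
  if x is inl _ then inl i else inr i.
have Pnth x0 i : P x0 -> P (nth (x0 : {classic (V1 + V2)}) l' i).
  move=> P0; have [/(mem_nth (x0 : {classic (V1 + V2)}))|/(nth_default _)->//] :=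
    ltnP i (size l').
  by rewrite mem_filter => /andP[/asboolP].
exists (size l).+1, (size l).+1, z1, z2, r; split.
  case=> i; rewrite /= /z1 /z2.
    by have := Pnth _ i P1; case: (nth _ _ _).
  by have := Pnth _ i P2; case: (nth _ _ _).
move=> x [Px /(_ x (mem_head _ _)) xl].
have xl' : (x : {classic (V1 + V2)}) \in l' by rewrite mem_filter xl asboolT.
have lt_x : (index (x : {classic (V1 + V2)}) l' < (size l).+1)%N.
  by rewrite ltnS (leq_trans (index_size _ _))// size_filter count_size.
move: xl' lt_x {Px xl}; case: x => x xl' lt_x;
  by rewrite /= /z1 /z2 inordK// nth_index.
Qed.

Lemma term_finite_variables (t : term L (V1 + V2)) : tvars P t ->
  exists m k (x1 : 'I_m -> V1) (x2 : 'I_k -> V2) (t0 : term L ('I_m + 'I_k)),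
    (forall x, P (enumerate_vars x1 x2 x)) /\
    forall (M : structure L) (v : V1 + V2 -> M),
      eval v t = eval (fun x => v (enumerate_vars x1 x2 x)) t0.
Proof.
move=> Pt.
have [l tl] := term_support (fun x : V1 + V2 => [:: x : {classic _}]) t.
have [m [k [x1 [x2 [r [Px rE]]]]]] := finite_renaming l.
exists m, k, x1, x2, (tsubst (fun x => tvar (r x)) t); split=> // M v.
rewrite eval_subst; apply: eval_eq (tvars_and Pt tl) _ => x /rE /= ->.
by [].
Qed.

Lemma formula_finite_variables (phi : formula L (V1 + V2)) : fvars phi P ->
  exists m k (x1 : 'I_m -> V1) (x2 : 'I_k -> V2)
    (phi0 : formula L ('I_m + 'I_k)),
    (forall x, P (enumerate_vars x1 x2 x)) /\
    forall (M : structure L) (v : V1 + V2 -> M),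
      sat phi v <-> sat phi0 (fun x => v (enumerate_vars x1 x2 x)).
Proof.
move=> Pphi.
have [l phi_l] := formula_support (fun x : V1 + V2 => [:: x : {classic _}]) phi.
have [m [k [x1 [x2 [r [Px rE]]]]]] := finite_renaming l.
exists m, k, x1, x2, (fsubst phi (fun x => tvar (r x))); split=> // M v.
rewrite sat_subst; apply: (sat_eq (fvars_and Pphi phi_l)) => x /rE /= ->.
by [].
Qed.

End FiniteVariables.

Section GapSequence.
Context {L : language} {M : structure L} {A : set M}.
Context {d : Order.disp_t} {I : orderType d} (c : I) (cut : two_sided_limit c).
Context {p : nat} (a : I -> 'I_p -> M).
Context (ind0 : indiscernible set0 [set: I] a).
Context (indA : indiscernible A [set i | i != c] a).

Definition term_sequence (m : nat) (X : 'I_m -> term L (I * 'I_p)) (lo hi : I)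
    (i : gap lo hi) (j : 'I_m) : M :=
  eval (pure_val a (moved c (val i))) (X j).

(** [derived_indiscernible] is applied twice: to the whole order without parameters, where the
    static terms are indexed by [void], and over [A] away from [c]. *)
Lemma term_sequence_indiscernible (m : nat) (W : Type)
    (X : 'I_m -> term L (I * 'I_p)) (E : W -> term L (I * 'I_p + A))
    (l : seq I) (lo0 hi0 : I) :
  (lo0 < c < hi0)%O ->
  (forall j, tvars (labels_in (fun x => [:: x.1]) l) (X j)) ->
  (forall w, tvars (labels_in label [seq h <- l | h != c]) (E w)) ->
  exists lo hi (c_gap : (lo < c < hi)%O),
    [/\ (lo0 <= lo)%O, (hi <= hi0)%O,
        indiscernible set0 [set: gap lo hi] (@term_sequence m X lo hi) &
        indiscernible (range (fun w => eval (base_val a) (E w)))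
          [set i | i != (exist _ c c_gap : gap lo hi)]
          (@term_sequence m X lo hi)].
Proof.
move=> c_gap0 Xl El.
have [lo [hi [lo0_lo c_gap hi_hi0 offl]]] := off_gap_exists_in l cut c_gap0.
have Xl' j : tvars (fun x => x.1 \in l) (X j).
  by apply: tvars_sub (Xl j) => x; apply; exact: mem_head.
exists lo, hi, c_gap; split=> //.
- have noE (w : void) : tvars (labels_in label [seq h <- l | h != c])
      (match w with end : term L (I * 'I_p + (set0 : set M))) by case: w.
  apply: (@indiscernible_subset _ _ _
    (range (fun w => eval (base_val a) (match w : void with end)))) => //.
  exact: (derived_indiscernible ind0 c_gap Logic.I offl
    (fun _ _ _ => Logic.I) Xl' noE).
- have /andP[lo_c _] := c_gap.
  exact: (derived_indiscernible indA c_gap (negbT (lt_eqF lo_c)) offl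
    (fun _ _ => id) Xl' El).
Qed.

End GapSequence.

Section ShiftLabels.
Context {d : Order.disp_t} {I : orderType d} (c : I) (cut : two_sided_limit c).
Local Open Scope order_scope.

(* Labels lying strictly between [i0] and [hi] are moved beyond [c], so that
   afterwards [c] and [i0] are in the same position with respect to all labels. *)
Lemma shift_labels (lo i0 hi : I) (l l' : seq I) :
  lo < i0 -> i0 < c -> c < hi -> off_gap c lo hi l ->
  {in l', forall h, h != c} ->
  exists hi' (f : I -> I),
    [/\ c < hi' <= hi, forall x, f x != c,
        {in l, forall x, x != c -> x != i0 /\ f x = x} &
        forall i, i0 < i < hi' ->
        {in i0 :: [seq h <- l | h != c] ++ l' &, forall x y,
          (x < y) = ((if x == i0 then i else f x) < (if y == i0 then i else f y))}].
Proof.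
move=> lo_i0 i0_c c_hi offl l'c.
(* Labels between [i0] and [hi] go to places from [hi'] on and below [hi], which leaves the interval
   from [i0] to [hi'], with [c] inside, to the moving point. *)
have [hi' c_hi' [g g_gap g_mono]] := squeeze_above cut l' c_hi.
pose f x := if x <= i0 then x else if x < hi then g x else x.
have hi'g x : hi' <= g x by have /andP[] := g_gap x.
have g_hi x : g x < hi by have /andP[] := g_gap x.
have hi'_hi : hi' < hi := le_lt_trans (hi'g c) (g_hi c).
have i0_hi : i0 < hi := lt_trans i0_c c_hi.
have offl' x : x \in l -> x != c -> x < i0 \/ hi <= x.
  move=> xl /(offl x xl)/orP[x_lo|]; last by right.
  by left; exact: le_lt_trans lo_i0.
exists hi', f; split.
- by rewrite c_hi' ltW.
- move=> x; rewrite /f; case: (leP x i0) => [x_i0|_].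
    by rewrite lt_eqF// (le_lt_trans x_i0).
  case: (ltP x hi) => x_hi; rewrite gt_eqF//.
    exact: lt_le_trans (hi'g x).
  exact: lt_le_trans x_hi.
- move=> x xl xc; have [x_i0|hi_x] := offl' x xl xc.
    by rewrite lt_eqF// /f ltW.
  have i0_x := lt_le_trans i0_hi hi_x.
  by rewrite gt_eqF// /f leNgt i0_x ltNge hi_x.
move=> i /andP[i0_i i_hi'].
pose fi x := if x == i0 then i else f x.
have memP x : x \in i0 :: [seq h <- l | h != c] ++ l' ->
    [\/ x <= i0, [/\ x \in l', i0 < x & x < hi] | hi <= x].
  rewrite inE mem_cat mem_filter => /or3P[/eqP ->|/andP[xc xl]|xl'].
  - by constructor 1.
  - by have [/ltW|] := offl' x xl xc; [constructor 1|constructor 3].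
  - have [x_i0|i0_x] := leP x i0; first by constructor 1.
    by have [x_hi|hi_x] := ltP x hi; [constructor 2|constructor 3].
have homo x y : x \in i0 :: [seq h <- l | h != c] ++ l' ->
    y \in i0 :: [seq h <- l | h != c] ++ l' -> x < y -> fi x < fi y.
  have fi_low x' : x' <= i0 -> fi x' <= i.
    rewrite /fi le_eqVlt => /predU1P[->|x'_i0]; first by rewrite eqxx.
    by rewrite lt_eqF// /f ltW// ltW// (lt_trans x'_i0).
  have fi_mid x' : i0 < x' -> x' < hi -> fi x' = g x'.
    by move=> i0_x' x'_hi; rewrite /fi gt_eqF// /f leNgt i0_x' x'_hi.
  have fi_high x' : hi <= x' -> fi x' = x'.
    move=> hi_x'; have i0_x' := lt_le_trans i0_hi hi_x'.
    by rewrite /fi gt_eqF// /f leNgt i0_x' ltNge hi_x'.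
  move=> /memP[x_i0|[xl' i0_x x_hi]|hi_x] /memP[y_i0|[yl' i0_y y_hi]|hi_y] xy.
  - have x_i0' := lt_le_trans xy y_i0.
    rewrite /fi (lt_eqF x_i0') {1}/f x_i0; case: eqVneq => _.
      exact: lt_trans i0_i.
    by rewrite /f y_i0.
  - rewrite (fi_mid y)//; apply: le_lt_trans (fi_low x x_i0) _.
    exact: lt_le_trans (hi'g y).
  - rewrite (fi_high y)//; apply: le_lt_trans (fi_low x x_i0) _.
    exact: lt_le_trans (lt_trans i_hi' hi'_hi) hi_y.
  - by have := lt_trans i0_x xy; rewrite ltNge y_i0.
  - by rewrite !fi_mid//; exact: g_mono.
  - by rewrite (fi_mid x)// (fi_high y)//; exact: lt_le_trans hi_y.
  - by have := lt_le_trans i0_hi hi_x; rewrite ltNge (ltW (lt_le_trans xy y_i0)).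
  - by have := lt_trans xy y_hi; rewrite ltNge hi_x.
  - by rewrite !fi_high.
move=> x y xl yl; rewrite -/(fi x) -/(fi y).
case: (ltgtP x y) => [xy|yx|->]; last by rewrite ltxx.
- by rewrite homo.
- by rewrite (lt_gtF (homo _ _ yl xl yx)).
Qed.

End ShiftLabels.

(** * Terms of the expansion near the cut *)

Section ReducibleTerms.
Context {L : language} {M : structure (expand L)} {A : set M}.
Context (zero : Defs.fsym L 0).
Context {d : Order.disp_t} {I : orderType d} (c : I) (cut : two_sided_limit c).
Context {p : nat} (a : I -> 'I_p -> M).

Local Notation moving := (term (expand L) (I * 'I_p)).
Local Notation static := (term (expand L) (I * 'I_p + A)).

Definition zero_term (V : Type) : term (expand L) V :=
  tlift (tapp zero (@args0 (term L V))).

Definition off_label (x : I * 'I_p + A) : Prop := c \notin label x.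

Definition mixed_val (i : I) : moving + static -> M :=
  vsum (eval (pure_val a (moved c i))) (eval (base_val a)).

Definition static_labels (x : moving + static) : Prop :=
  if x is inr e then tvars off_label e else True.

(* The label [c] stands for the moving point; all other labels stay in place. *)
Definition reducible (t : static) : Prop :=
  exists (u : term L (moving + static)) (lo hi : I),
    [/\ tvars static_labels u, (lo < c < hi)%O &
        forall i, (lo < i < hi)%O ->
          eval (vsum (pure_val a (moved c i)) set_val) t =
          @eval L (reduct M) _ (mixed_val i) u].

(** Stated for all longer lists, because a single list will collect the supports of several
    families. *)
Lemma static_support (W : finType) (E : W -> static) :
  (forall w, tvars off_label (E w)) ->
  exists l : seq I, forall l' : seq I, {subset l <= l'} ->
    forall w, tvars (labels_in label [seq h <- l' | h != c]) (E w).
Proof.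
move=> offE.
have [l lE] : exists l : seq I, forall i : 'I_#|W|,
    tvars (labels_in label l) (E (enum_val i)).
  apply: family_support => [i l l' ll'|i]; last exact: term_support.
  by apply: tvars_sub => x; exact: labels_in_sub.
exists l => l' ll' w; rewrite -(enum_rankK w).
apply: tvars_sub (tvars_and (lE (enum_rank w)) (offE _)) => x [xl xc] h hx.
rewrite mem_filter (ll' _ (xl _ hx)) andbT; apply: contraNneq xc => <-.
exact: hx.
Qed.

Lemma gap_family (n : nat) (lo hi : 'I_n -> I) :
  (forall j, (lo j < c < hi j)%O) -> exists lo' hi', (lo' < c < hi')%O /\
    forall j, (lo j <= lo')%O /\ (hi' <= hi j)%O.
Proof.
move=> gaps; have [lo' [hi' [c_gap offl]]] :=
  off_gap_exists (codom lo ++ codom hi) cut.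
exists lo', hi'; split=> // j; have /andP[lo_c c_hi] := gaps j; split.
- by apply: (off_gap_bounds c_gap offl _).1 => //; rewrite mem_cat codom_f.
- by apply: (off_gap_bounds c_gap offl _).2 => //; rewrite mem_cat codom_f orbT.
Qed.

Lemma gap_le (lo hi lo' hi' i : I) : (lo <= lo')%O -> (hi' <= hi)%O ->
  (lo' < i < hi')%O -> (lo < i < hi)%O.
Proof.
move=> lo_le hi_le /andP[lo'_i i_hi'].
by rewrite (le_lt_trans lo_le) ?(lt_le_trans i_hi').
Qed.

Lemma reducible_family (n : nat) (t : 'I_n -> static) :
  (forall j, reducible (t j)) ->
  exists (u : 'I_n -> term L (moving + static)) (lo hi : I),
    [/\ forall j, tvars static_labels (u j), (lo < c < hi)%O &
        forall i, (lo < i < hi)%O -> forall j,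
          eval (vsum (pure_val a (moved c i)) set_val) (t j) =
          @eval L (reduct M) _ (mixed_val i) (u j)].
Proof.
move=> /choice[u /choice[lo /choice[hi H]]].
have [|lo' [hi' [c_gap lo_hi]]] := gap_family (lo := lo) (hi := hi).
  by move=> j; case: (H j).
exists u, lo', hi'; split=> // [j|i i_gap j]; first by case: (H j).
case: (H j) => _ _; apply; have [lo_le hi_le] := lo_hi j.
exact: gap_le i_gap.
Qed.

Lemma reducible_var x : reducible (tvar x).
Proof.
have [lo lo_c] := limit_below cut; have [hi c_hi] := limit_above cut.
case: x => [x|z].
  exists (tvar (inl (tvar x))), lo, hi; split=> //; first by rewrite lo_c.
exists (tvar (inr (tvar (inr z)))), lo, hi; split=> //; by rewrite lo_c.
Qed.

Lemma reducible_old (n : nat) (f : Defs.fsym L n) (args : 'I_n -> static) :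
  (forall j, reducible (args j)) ->
  reducible (@tapp (expand L) _ n (old_sym f) args).
Proof.
move=> /reducible_family[u [lo [hi [u_static c_gap uE]]]].
exists (tapp f u), lo, hi; split=> // i i_gap /=.
congr fun_int; apply/funext => j; exact: uE.
Qed.

Definition sequence_hull : set M :=
  [set x | exists2 t : moving, tvars (fun z => z.1 != c) t &
    x = eval (pure_val a id) t].

Lemma sequence_hull_closed n (f : Defs.fsym (expand L) n) (args : 'I_n -> M) :
  (forall i, sequence_hull (args i)) -> sequence_hull (fun_int M f args).
Proof.
move=> /(_ _)/cid2-/all_sig2[t t_off tE].
exists (tapp f t) => //=; congr fun_int; exact/funext.
Qed.

Lemma sequence_hull_neq0 : sequence_hull !=set0.
Proof. by exists (eval (pure_val a id) (zero_term _)), (zero_term _) => // -[]. Qed.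

Definition sequence_substructure : substructure (reduct M) :=
  @Substructure L (reduct M) sequence_hull sequence_hull_neq0
    (fun n f => @sequence_hull_closed n (old_sym f)).

Lemma new_fun_hull x : sequence_hull x -> sequence_hull (new_fun x).
Proof. by move=> hx; apply: sequence_hull_closed. Qed.

Definition static_value (x : M) : Prop :=
  exists2 e : static, tvars off_label e & x = eval (base_val a) e.

Lemma generated_static (X : set M) x : X `<=` static_value ->
  @generated L (reduct M) X x -> static_value x.
Proof.
move=> Xs; elim=> [y /Xs//|n f args _].
move=> /(_ _)/cid2-/all_sig2[e e_off eE].
exists (@tapp (expand L) _ n (old_sym f) e) => //=; congr fun_int; exact/funext.
Qed.

Lemma hull_static x : sequence_hull x -> static_value x.
Proof.
move=> [t t_off ->]; exists (tsubst (fun z => tvar (inl z)) t).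
  by apply: tvars_subst t_off => -[h j] /=; rewrite /off_label mem_seq1 eq_sym.
by rewrite eval_subst.
Qed.

(** The outer new symbol is kept in the syntax, so that the value stays in the range of $\mathfrak
    f$ when labels are moved; (iii) asks this of the first [n] coordinates. *)
Definition moving_new (t : moving) : Prop :=
  exists2 t' : moving, t = tnew t' & tvars (fun z => z.1 != c) t'.

Lemma generated_new_hull (k : nat) (D : 'I_k -> static) (P : static -> Prop) y :
  (forall j, P (D j)) ->
  @generated L (reduct M)
    (@new_fun L M @` sequence_hull `|` range (fun j => eval (base_val a) (D j))) y ->
  exists2 h : term L (moving + static),
    tvars (fun x => match x with inl t => moving_new t | inr e => P e end) h &
    y = @eval L (reduct M) _ (mixed_val c) h.
Proof.
move=> PD; elim=> [_ [[x [t t_off ->] <-]|[j _ <-]]|n f args _].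
- exists (tvar (inl (tnew t))); first by exists t.
  rewrite /= /new_fun; congr fun_int; apply/funext => _.
  by congr (eval _ _); apply/funext => z; rewrite /pure_val moved_id.
- by exists (tvar (inr (D j))); first exact: PD.
- move=> /(_ _)/cid2-/all_sig2[e e_off eE].
  exists (tapp f e) => //=; congr fun_int; exact/funext.
Qed.

Context (ind0 : indiscernible set0 [set: I] a).
Context (indA : indiscernible A [set i | i != c] a).
Context (pres : preserves_equations M (@two_sided_limit)).
Context (hull_bounded : forall (k : nat) (b : 'I_k -> M),
  let Bc : set M := @generated L (reduct M) (sequence_hull `|` range b) in
  exists (l : nat) (e : 'I_l -> M),
    (forall j, (@new_fun L M @` Bc) (e j)) /\
    @new_fun L M @` Bc `<=`
      @generated L (reduct M) (@new_fun L M @` sequence_hull `|` range e)).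

Lemma reducible_new (t : static) : reducible t -> reducible (tnew t).
Proof.
case=> u [lo0 [hi0 [u_static c_gap0 uE]]].
have [||m1 [k1 [X1 [E1 [u0 [u0_static u0E]]]]]] :=
  term_finite_variables (d1 := zero_term _) (d2 := zero_term _) _ _ u_static => //.
  by case.
have E1_off j : tvars off_label (E1 j) := u0_static (inr j).
pose b1 j := eval (base_val a) (E1 j).
(* Condition (ii) for the hull together with [b1]. The generators [e j] are again values of static
   terms, since the elements of the hull and of [b1] are. *)
have [k [e [fe e_gen]]] := hull_bounded b1.
have b1_static : sequence_hull `|` range b1 `<=` static_value.
  by move=> x [/hull_static//|[j _ <-]]; exists (E1 j).
have e_static j : static_value (e j).
  have [x x_gen <-] := fe j.
  have [ex ex_off ->] := generated_static b1_static x_gen.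
  by exists (tnew ex).
have /choice[D DP] j : exists D : static,
    tvars off_label D /\ e j = eval (base_val a) D.
  by have [D D_off DE] := e_static j; exists D.
have [l1 l1P] : exists l : seq I,
    forall j, tvars (labels_in (fun x => [:: x.1]) l) (X1 j).
  apply: family_support => [j l l' ll'|j]; last exact: term_support.
  by apply: tvars_sub => x; exact: labels_in_sub.
have [l2 l2P] := static_support E1_off.
have [l3 l3P] := static_support (fun j => (DP j).1).
pose l := l1 ++ l2 ++ l3.
have [lo [hi [lo0_lo c_gap hi_hi0 offl]]] := off_gap_exists_in l cut c_gap0.
have /andP[lo_c c_hi] := c_gap.
have [i0 lo_i0 i0_c] := limit_from_below cut lo_c.
have i0_gap : (lo < i0 < hi)%O by rewrite lo_i0 (lt_trans i0_c).
pose value i := @eval L (reduct M) _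
  (vsum (fun j => eval (pure_val a (moved c i)) (X1 j)) b1) u0.
have valueE i : (lo < i < hi)%O ->
    eval (vsum (pure_val a (moved c i)) set_val) t = value i.
  move=> i_gap; rewrite uE ?(gap_le lo0_lo hi_hi0 i_gap)// u0E.
  by apply: (@eval_eq _ (reduct M) _ (fun=> True)) => [|[]//]; exact: tvarsT.
(* With [c] replaced by [i0] the moving terms name elements of the hull, so [e_gen] applies to the
   value at [i0]. *)
have value_gen : @generated L (reduct M) (sequence_hull `|` range b1) (value i0).
  apply: eval_generated => -[j|j]; apply: gen_base; last by right; exists j.
  left; exists (tsubst (fun x => tvar (moved c i0 x.1, x.2)) (X1 j)).
    apply: (tvars_subst (P := fun=> True)); last exact: tvarsT.
    move=> [x q] _; rewrite /= /moved; case: (eqVneq x c) => // _.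
    by rewrite lt_eqF.
  by rewrite eval_subst.
have eD : e = (fun j => eval (base_val a) (D j)) by apply/funext => j; case: (DP j).
(* Besides avoiding [c], the parameters [b2] of (iii) must lie in the range of $\mathfrak f$. *)
pose good_static (s : static) : Prop :=
  tvars (labels_in label [seq h <- l | h != c]) s /\
  range (@new_fun L M) (eval (base_val a) s).
have good_D j : good_static (D j).
  split; first by apply: l3P => h hl; rewrite !mem_cat hl !orbT.
  by have [x _ fx] := fe j; exists x => //; rewrite fx (DP j).2.
have := e_gen _ (imageP _ value_gen); rewrite eD.
move=> /(generated_new_hull good_D)[h h_good hE].
(* $\mathfrak f(0)$ is the padding: it has the form required of both kinds of terms. *)
have zero_new : moving_new (tnew (zero_term _)).
  by exists (zero_term _) => // -[].
have zero_static : good_static (tnew (zero_term _)).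
  by split; [move=> _ -[]|exists (eval (base_val (A := A) a) (zero_term _))].
have [n [k2 [X2 [E2 [h0 [h0_good h0E]]]]]] :=
  term_finite_variables (d1 := tnew (zero_term _)) (d2 := tnew (zero_term _))
    zero_new zero_static h_good.
have X2_new j : moving_new (X2 j) := h0_good (inl j).
have E2_good j : good_static (E2 j) := h0_good (inr j).
have [l4 l4P] : exists l : seq I,
    forall j, tvars (labels_in (fun x => [:: x.1]) l) (X2 j).
  apply: family_support => [j l' l'' ll'|j]; last exact: term_support.
  by apply: tvars_sub => x; exact: labels_in_sub.
have X2_off j : tvars (fun z => z.1 != c) (X2 j).
  by have [t' -> t'_off] := X2_new j.
pose l4' := [seq h <- l4 | h != c].
have l4'c : {in l4', forall h, h != c} by move=> x; rewrite mem_filter => /andP[].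
have X2l j : tvars (fun z => z.1 \in l4') (X2 j).
  apply: tvars_sub (tvars_and (X2_off j) (l4P j)) => z [zc zl].
  by rewrite mem_filter zc zl ?mem_head.
have [hi' [f [/andP[c_hi' hi'_hi] f_c f_l f_lt]]] :=
  shift_labels cut lo_i0 i0_c c_hi offl l4'c.
(* Where [X2] contains the label [i0], that label stands for the moving point and becomes [c]; all
   other labels are shifted by [f]. *)
pose X2' j : moving :=
  tsubst (fun z => tvar (if z.1 == i0 then c else f z.1, z.2)) (X2 j).
pose b2 j := eval (base_val a) (E2 j).
pose rhs (g : I -> I) := @eval L (reduct M) _
  (vsum (fun j => eval (pure_val a g) (X2 j)) b2) h0.
pose labels := i0 :: [seq h <- l | h != c] ++ l4'.
pose s1 (x : 'I_m1 + 'I_k1) : static :=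
  match x with
  | inl j => tsubst (fun z => tvar (inl (moved c i0 z.1, z.2))) (X1 j)
  | inr j => E1 j
  end.
pose s2 (x : 'I_n + 'I_k2) : static :=
  match x with
  | inl j => tsubst (fun z => tvar (inl z)) (X2 j)
  | inr j => E2 j
  end.
(* The equation at [i0], written with [i0] for every label [c], so that indiscernibility away from
   [c] applies to it. *)
pose F := feq (tnew (tsubst s1 (tlift u0))) (tsubst s2 (tlift h0)).
have satF (g : I -> I) : {in l, forall x, x != c -> g x = x} ->
    sat F (vsum (fun x => a (g x.1) x.2) set_val) <->
    new_fun (value (g i0)) = rhs g.
  move=> gl.
  have fixE (E : static) : tvars (labels_in label [seq h <- l | h != c]) E ->
      eval (vsum (fun x => a (g x.1) x.2) set_val) E = eval (base_val a) E.
    move=> El; apply: eval_eq El _ => -[[x q]|//] /(_ x (mem_head _ _)).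
    by rewrite mem_filter => /andP[xc xl]; rewrite /= gl.
  have E1l j : tvars (labels_in label [seq h <- l | h != c]) (E1 j).
    by apply: l2P => x xl; rewrite !mem_cat xl orbT.
  rewrite [sat _ _]/= !eval_subst !eval_lift /value /rhs.
  rewrite (_ : (fun x => eval _ (s1 x)) =
    vsum (fun j => eval (pure_val a (moved c (g i0))) (X1 j)) b1); last first.
    apply/funext => -[j|j] /=; last exact: fixE.
    rewrite eval_subst; apply: eval_eq (l1P j) _ => -[x q] /(_ x (mem_head _ _)) xl.
    rewrite /= /pure_val /moved /=; case: (eqVneq x c) => // xc.
    by rewrite gl// !mem_cat xl.
  rewrite (_ : (fun x => eval _ (s2 x)) =
    vsum (fun j => eval (pure_val a g) (X2 j)) b2)//.
  apply/funext => -[j|j] /=; first by rewrite eval_subst.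
  exact: fixE (E2_good j).1.
have F_labels : fvars F (labels_in label labels).
  split=> [_|].
    apply: (tvars_subst (P := fun=> True)); last exact: tvarsT.
    move=> [j|j] _ /=.
      apply: tvars_subst (l1P j) => -[x q] /(_ x (mem_head _ _)) xl h'.
      rewrite mem_seq1 => /eqP -> /=; rewrite /moved.
      case: (eqVneq x c) => [_|xc]; first exact: mem_head.
      by rewrite in_cons mem_cat mem_filter xc !mem_cat xl !orbT.
    apply: (tvars_sub (P := labels_in label [seq h <- l | h != c])); last first.
      by apply: l2P => x xl; rewrite !mem_cat xl orbT.
    move=> x; apply: labels_in_sub => y yl.
    by rewrite in_cons mem_cat yl orbT.
  apply: (tvars_subst (P := fun=> True)); last exact: tvarsT.
  move=> [j|j] _ /=.
    apply: tvars_subst (X2l j) => -[x q] /= xl h'.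
    by rewrite mem_seq1 => /eqP ->; rewrite in_cons mem_cat xl !orbT.
  apply: tvars_sub (E2_good j).1 => x; apply: labels_in_sub => y yl.
  by rewrite in_cons mem_cat yl orbT.
have labels_c : {in labels, forall x, x != c}.
  move=> x; rewrite in_cons mem_cat => /or3P[/eqP ->||/l4'c//].
    by rewrite lt_eqF.
  by rewrite mem_filter => /andP[].
have rhsE i : rhs (fun x => if x == i0 then i else f x) =
    @eval L (reduct M) _
      (vsum (fun j => eval (pure_val a (moved c i)) (X2' j)) b2) h0.
  rewrite /rhs; apply: (@eval_eq _ (reduct M) _ (fun=> True)) => [|[j|//] _].
    exact: tvarsT.
  rewrite /= eval_subst; congr (eval _ _); apply/funext => z.
  rewrite /= /pure_val /moved /=; case: (eqVneq z.1 i0) => _ /=.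
    by rewrite eqxx.
  by rewrite (negbTE (f_c _)).
have F_id : sat F (vsum (fun x => a x.1 x.2) set_val).
  apply/(satF id) => //; rewrite hE h0E.
  apply: (@eval_eq _ (reduct M) _ (fun=> True)) => [|[j|//] _]; first exact: tvarsT.
  rewrite /=; congr (eval _ _); apply/funext => z.
  by rewrite /pure_val moved_id.
have eqn i : (i0 < i < hi')%O -> i != c -> new_fun (value i) =
    @eval L (reduct M) _
      (vsum (fun j => eval (pure_val a (moved c i)) (X2' j)) b2) h0.
  move=> i_gap ic; rewrite -rhsE.
  pose g x := if x == i0 then i else f x.
  have gl : {in l, forall x, x != c -> g x = x}.
    by move=> x xl xc; have [xi0 fx] := f_l x xl xc; rewrite /g (negbTE xi0).
  have gi0 : g i0 = i by rewrite /g eqxx.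
  have := (satF g gl).1; rewrite gi0; apply.
  apply: (indiscernible_labels (k0 := i0) (l := labels) (f := id) (g := g)
    indA _ F_labels _ _ _ _).1 F_id => //.
  - by move=> w; exact/set_mem/(valP w).
  - exact: mem_head.
  - by move=> x _; rewrite /= /g; case: (eqVneq x i0).
  - exact: f_lt.
(* Condition (iii) wants the coordinates in the range of $\mathfrak f$ first, hence [X2'] before
   [X1]. *)
pose X (j : 'I_(n + m1)) : moving :=
  match fintype.split j with inl j => X2' j | inr j => X1 j end.
have le_n : (n <= n + m1)%N := leq_addr m1 n.
have XE2 j : X (widen_ord le_n j) = X2' j.
  have -> : widen_ord le_n j = lshift m1 j by exact: val_inj.
  by rewrite /X (unsplitK (inl j)).
have XE1 j : X (rshift n j) = X1 j by rewrite /X (unsplitK (inr j)).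
have [l5 l5P] : exists l : seq I,
    forall j, tvars (labels_in (fun x => [:: x.1]) l) (X j).
  apply: family_support => [j l' l'' ll'|j]; last exact: term_support.
  by apply: tvars_sub => x; exact: labels_in_sub.
have E2_off j : tvars off_label (E2 j).
  apply: tvars_sub (E2_good j).1 => x xl; apply/negP => /xl.
  by rewrite mem_filter eqxx.
pose E (x : 'I_k1 + 'I_k2) : static :=
  match x with inl j => E1 j | inr j => E2 j end.
have [|l6 l6P] := @static_support ('I_k1 + 'I_k2)%type E; first by case.
have i0_gap' : (i0 < c < hi')%O by rewrite i0_c.
have [||lo' [hi'' [c_gap' [i0_lo' hi''_hi' indX0 indXE]]]] :=
  term_sequence_indiscernible cut ind0 indA (l := l5 ++ l6) (X := X) (E := E)
    i0_gap'.
- move=> j; apply: tvars_sub (l5P j) => x; apply: labels_in_sub => y yl.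
  by rewrite mem_cat yl.
- by apply: l6P => x xl; rewrite mem_cat xl orbT.
have E_range : range (fun w => eval (base_val a) (E w)) = range b1 `|` range b2.
  apply/seteqP; split=> z.
    by move=> [[j|j] _ <-]; [left; exists j|right; exists j].
  by move=> [[j _ <-]|[j _ <-]]; [exists (inl j)|exists (inr j)].
rewrite E_range in indXE.
pose seqX := @term_sequence _ _ _ _ c _ a _ X lo' hi''.
pose g0 := tsubst (fun x : 'I_m1 + 'I_k1 => tvar (match x with
  inl j => inl (rshift n j) | inr j => inr j end : 'I_(n + m1) + 'I_k1)) u0.
have g0E i : @eval L (reduct M) _ (vsum (seqX i) b1) g0 =
    value (val i).
  rewrite eval_subst; apply: (@eval_eq _ (reduct M) _ (fun=> True)) => [|[j|//] _].
    exact: tvarsT.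
  by rewrite /= /seqX /term_sequence XE1.
have h0E' (i : gap lo' hi'') :
    @eval L (reduct M) _ (vsum (fun j => seqX i (widen_ord le_n j)) b2) h0 =
    @eval L (reduct M) _
      (vsum (fun j => eval (pure_val a (moved c (val i))) (X2' j)) b2) h0.
  apply: (@eval_eq _ (reduct M) _ (fun=> True)) => [|[j|//] _]; first exact: tvarsT.
  by rewrite /= /seqX /term_sequence XE2.
have gap'_sub i : (lo' < i < hi'')%O -> (i0 < i < hi')%O.
  exact: gap_le i0_lo' hi''_hi'.
have eqn_c : new_fun (value c) = @eval L (reduct M) _
    (vsum (fun j => eval (pure_val a (moved c c)) (X2' j)) b2) h0.
  pose c' : gap lo' hi'' := exist _ c c_gap'.
  have fb2 j : range (@new_fun L M) (b2 j) := (E2_good j).2.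
  have fX i (j : 'I_n) : range (@new_fun L M) (seqX i (widen_ord le_n j)).
    rewrite /seqX /term_sequence XE2 /X2'; have [t' -> _] := X2_new j.
    by eexists => //; rewrite /= /new_fun.
  have eq_off i : i != c' ->
      new_fun (@eval L (reduct M) _ (vsum (seqX i) b1) g0) =
      @eval L (reduct M) _ (vsum (fun j => seqX i (widen_ord le_n j)) b2) h0.
    move=> ic; rewrite g0E h0E'; apply: eqn; first exact/gap'_sub/(valP i).
    by rewrite -(inj_eq val_inj) in ic.
  have := pres fb2 fX (gap_limit c_gap' cut) indX0 indXE eq_off.
  by rewrite g0E h0E'.
pose r (x : 'I_n + 'I_k2) : term L (moving + static) :=
  tvar (match x with inl j => inl (X2' j) | inr j => inr (E2 j) end).
exists (tsubst r h0), lo', hi''; split=> //.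
  apply: (tvars_subst (P := fun=> True)); last exact: tvarsT.
  by move=> [j|j] _ //; exact: E2_off.
move=> i i_gap.
have i_gap0 : (lo < i < hi)%O.
  exact: gap_le (ltW lo_i0) hi'_hi (gap'_sub _ i_gap).
rewrite [eval _ (tnew t)]/= -/(new_fun _) valueE// eval_subst.
have -> : new_fun (value i) = @eval L (reduct M) _
      (vsum (fun j => eval (pure_val a (moved c i)) (X2' j)) b2) h0.
  by case: (eqVneq i c) => [->//|]; exact/eqn/gap'_sub.
apply: (@eval_eq _ (reduct M) _ (fun=> True)) => [|[j|j] _] //.
exact: tvarsT.
Qed.

Lemma reducible_all (t : static) : reducible t.
Proof.
elim: t => [x|n f args IH]; first exact: reducible_var.
case: f args IH => [m f|] args IH; first exact: reducible_old.
have -> : args = fun=> args ord0 by apply/funext => j; rewrite ord1.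
exact/reducible_new/IH.
Qed.

End ReducibleTerms.

(** * From terms to formulas of the expansion *)

Section LocalFormulas.
Context {L : language} {M : structure (expand L)} {A : set M}.
Context (S : oag_symbols L) (M_oag : ordered_abelian_group S (reduct M)).
Context (M_omin : o_minimal S (reduct M)).
Context {d : Order.disp_t} {I : orderType d} (c : I) (cut : two_sided_limit c).
Context {p : nat} (a : I -> 'I_p -> M).
Context (ind0 : indiscernible set0 [set: I] a).
Context (indA : indiscernible A [set i | i != c] a).

Local Notation moving := (term (expand L) (I * 'I_p)).
Local Notation static := (term (expand L) (I * 'I_p + A)).

(** O-minimal distality for the sequence of values of the finitely many moving terms in [chi], over
    the values of its static terms; indiscernibility for one-element tuples then compares [i] with
    [c]. *)
Lemma local_reduct_formula (chi : formula L (moving + static)) (lo0 hi0 : I) :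
  fvars chi (static_labels c) -> (lo0 < c < hi0)%O ->
  exists lo hi, [/\ (lo0 <= lo)%O, (hi <= hi0)%O, (lo < c < hi)%O &
    forall i, (lo < i < hi)%O ->
      @sat L (reduct M) _ chi (mixed_val c a i) <->
      @sat L (reduct M) _ chi (mixed_val c a c)].
Proof.
move=> chi_static c_gap0.
pose z (V : Type) : term (expand L) V := zero_term (sym_zero S) V.
have [|| m [k [X [E [chi0 [chi0_static chi0E]]]]]] :=
  formula_finite_variables (d1 := z _) (d2 := z _) _ _ chi_static => //.
  by case.
have E_off j : tvars (off_label c) (E j) := chi0_static (inr j).
have [l lX] : exists l : seq I,
    forall j, tvars (labels_in (fun x => [:: x.1]) l) (X j).
  apply: family_support => [j l l' ll'|j]; last exact: term_support.
  by apply: tvars_sub => x; exact: labels_in_sub.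
have [l' l'E] := static_support E_off.
have [||lo [hi [c_gap [lo0_lo hi_hi0 indX0 indXE]]]] :=
  term_sequence_indiscernible cut ind0 indA (l := l ++ l') (X := X) (E := E)
    c_gap0.
- move=> j; apply: tvars_sub (lX j) => x; apply: labels_in_sub => y yl.
  by rewrite mem_cat yl.
- by apply: l'E => x xl; rewrite mem_cat xl orbT.
exists lo, hi; split=> // i i_gap.
pose b j := eval (base_val a) (E j).
have indL := @o_minimal_distal L S (reduct M) M_oag M_omin _ _ _ _ _
  (gap_limit c_gap cut) _ b (indiscernible_reduct indX0) (indiscernible_reduct indXE).
have bP j : b j \in range b by apply/mem_set; exists j.
pose s (x : 'I_m + 'I_k) : term L ('I_1 * 'I_m + range b) :=
  tvar (match x with
        | inl j => inl (ord0, j)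
        | inr j => inr (exist (fun y => y \in range b) _ (bP j))
        end).
have inc1 (i' : gap lo hi) : increasing_tuple (fun _ : 'I_1 => i').
  by move=> s1 s2; rewrite !ord1.
have satE (i' : gap lo hi) :
    @sat L (reduct M) _ (fsubst chi0 s)
      (vsum (fun x => term_sequence c a X i' x.2) set_val) <->
    @sat L (reduct M) _ chi (mixed_val c a (val i')).
  rewrite chi0E sat_subst.
  apply: (@sat_eq _ (reduct M) _ (fun=> True)) => [|[j|j] _] //.
  exact: fvarsT.
have := indL 1 (fun=> exist _ i i_gap) (fun=> exist _ c c_gap)
  (fun=> Logic.I) (fun=> Logic.I) (inc1 _) (inc1 _) (fsubst chi0 s).
by rewrite !satE.
Qed.

Context (pres : preserves_equations M (@two_sided_limit)).
Context (hull_bounded : forall (k : nat) (b : 'I_k -> M),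
  let Bc : set M := @generated L (reduct M) (sequence_hull c a `|` range b) in
  exists (l : nat) (e : 'I_l -> M),
    (forall j, (@new_fun L M @` Bc) (e j)) /\
    @new_fun L M @` Bc `<=`
      @generated L (reduct M) (@new_fun L M @` sequence_hull c a `|` range e)).

Lemma local_reduct_substitution (n : nat) (t : 'I_n -> static)
    (chi : formula L 'I_n) :
  exists lo hi, (lo < c < hi)%O /\ forall i, (lo < i < hi)%O ->
    @sat L (reduct M) _ chi
      (fun j => eval (vsum (pure_val a (moved c i)) set_val) (t j)) <->
    @sat L (reduct M) _ chi (fun j => eval (base_val a) (t j)).
Proof.
have [u [lo0 [hi0 [u_static c_gap0 uE]]]] := reducible_family cut
  (fun j => reducible_all (sym_zero S) cut ind0 indA pres hull_bounded (t j)).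
have [|lo [hi [lo0_lo hi_hi0 c_gap chiE]]] :=
  @local_reduct_formula (fsubst chi u) lo0 hi0 _ c_gap0.
  by apply: (fvars_subst (P := fun=> True)) (fvarsT _ _).
exists lo, hi; split=> // i i_gap.
have E i' : (lo < i' < hi)%O ->
    @sat L (reduct M) _ (fsubst chi u) (mixed_val c a i') <->
    @sat L (reduct M) _ chi
      (fun j => eval (vsum (pure_val a (moved c i')) set_val) (t j)).
  move=> i'_gap; rewrite sat_subst.
  rewrite (_ : (fun j => eval (vsum _ _) (t j)) =
    fun j => @eval L (reduct M) _ (mixed_val c a i') (u j))//.
  by apply/funext => j; apply: uE; exact: gap_le i'_gap.
have -> : (fun j => eval (base_val a) (t j)) =
    fun j => eval (vsum (pure_val a (moved c c)) set_val) (t j).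
  apply/funext => j; congr (eval _ _); apply/funext => -[x|//] /=.
  by rewrite /pure_val moved_id.
by rewrite -!E//; exact: chiE.
Qed.

(** The expansion adds no relation symbols, so an atomic formula is one of $\mathcal L$ with terms
    of the expansion substituted. Implications need only a common gap. *)
Lemma local_quantifier_free (V : Type) (phi : formula (expand L) V)
    (s : V -> static) : quantifier_free phi ->
  exists lo hi, (lo < c < hi)%O /\ forall i, (lo < i < hi)%O ->
    sat phi (fun x => eval (vsum (pure_val a (moved c i)) set_val) (s x)) <->
    sat phi (fun x => eval (base_val a) (s x)).
Proof.
elim: phi s => {V} [V t u|V n r args|V|V q1 IH1 q2 IH2|//] s.
- move=> _; pose tu (j : 'I_2) := tsubst s (args2 t u j).
  have [lo [hi [c_gap H]]] :=
    @local_reduct_substitution 2 tu (feq (tvar ord0) (tvar ord_max)).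
  by exists lo, hi; split=> // i /H; rewrite /= /tu !eval_subst.
- move=> _; have [lo [hi [c_gap H]]] :=
    @local_reduct_substitution n (fun j => tsubst s (args j)) (@Defs.frel L _ n r tvar).
  exists lo, hi; split=> // i /H /=.
  rewrite (_ : (fun j => eval (vsum _ _) (tsubst s (args j))) =
    fun j => eval (fun x => eval (vsum (pure_val a (moved c i)) set_val) (s x))
      (args j)).
    rewrite (_ : (fun j => eval (base_val a) (tsubst s (args j))) =
      fun j => eval (fun x => eval (base_val a) (s x)) (args j))//.
    by apply/funext => j; rewrite eval_subst.
  by apply/funext => j; rewrite eval_subst.
- move=> _; have [lo lo_c] := limit_below cut; have [hi c_hi] := limit_above cut.
  by exists lo, hi; rewrite lo_c.
- move=> [/(IH1 s)[lo1 [hi1 [gap1 H1]]] /(IH2 s)[lo2 [hi2 [gap2 H2]]]].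
  have [|lo [hi [c_gap lo_hi]]] := gap_family cut
    (lo := fun j : 'I_2 => if j == ord0 then lo1 else lo2)
    (hi := fun j : 'I_2 => if j == ord0 then hi1 else hi2).
    by move=> j; case: eqP.
  exists lo, hi; split=> // i i_gap.
  have [lo_1 hi_1] := lo_hi ord0; have [lo_2 hi_2] := lo_hi ord_max.
  have := H1 i (gap_le lo_1 hi_1 i_gap); have := H2 i (gap_le lo_2 hi_2 i_gap).
  by rewrite /=; tauto.
Qed.

End LocalFormulas.

Theorem theorem2p1 (L : language) (S : oag_symbols L) (T : theory L)
  (Tf : theory (expand L)) (kappa : Type) (M : structure (expand L))
  (T_complete : complete T)
  (T_oag : extends_oag S T)
  (T_omin : o_minimal_theory S T)
  (T_qe : quantifier_elimination T)
  (T_univ : universally_axiomatizable T)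
  (Tf_complete : complete Tf)
  (Tf_T : extends_theory T Tf)
  (M_monster : monster kappa Tf M)
  (cond_i : quantifier_elimination Tf)
  (cond_ii :
    forall C : structure (expand L), models C Tf ->
    forall B : substructure (reduct C), elementary B ->
    @new_fun L C @` B `<=` B ->
    forall (k : nat) (c : 'I_k -> C),
    let Bc : set C := @generated L (reduct C) (B `|` range c) in
    exists (l : nat) (d : 'I_l -> C),
      (forall j, (@new_fun L C @` Bc) (d j)) /\
      @new_fun L C @` Bc `<=`
        @generated L (reduct C) (@new_fun L C @` B `|` range d))
  (cond_iii :
    forall (n m k l : nat) (le_nm : (n <= m)%N)
      (g : term L ('I_m + 'I_k)) (h : term L ('I_n + 'I_l))
      (b1 : 'I_k -> M) (b2 : 'I_l -> M),
    (forall j, range (@new_fun L M) (b2 j)) ->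
    forall (disp : Order.disp_t) (I : orderType disp) (c : I)
      (a : I -> 'I_m -> M),
    (forall i (j : 'I_n), range (@new_fun L M) (a i (widen_ord le_nm j))) ->
    interior_cut c ->
    indiscernible set0 [set: I] a ->
    indiscernible (range b1 `|` range b2) [set i | i != c] a ->
    let equation (i : I) : Prop :=
      new_fun (@eval L (reduct M) _ (vsum (a i) b1) g) =
      @eval L (reduct M) _
        (vsum (fun j : 'I_n => a i (widen_ord le_nm j)) b2) h in
    (forall i, i != c -> equation i) -> equation c) :
  distal kappa M.
Proof.
have M_T := Tf_T M (monster_models M_monster).
have [M_oag _] := T_oag _ M_T; have M_omin := T_omin _ M_T.
have pres := preserves_equations_limit (monster_large M_monster)
  (monster_saturated M_monster) cond_iii.
move=> A _ disp I c p a /interior_cut_limit cut ind0 indA.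
apply: (indiscernible_of_local cut indA) => psi.
have [psi' psi'_qf psiE] := quantifier_free_equivalent
  (tlift (tapp (sym_zero S) (@args0 (term L void)))) psi cond_i
  (monster_models M_monster).
(* Condition (ii) is used inside [M] itself, with this hull as the elementary substructure. *)
pose B := sequence_substructure (sym_zero S) c a.
have B_elem : elementary B := elementary_substructure T_univ T_qe M_T.
have B_new : @new_fun L M @` B `<=` B.
  by move=> _ [x Bx <-]; exact: new_fun_hull.
have hull k := @cond_ii M (monster_models M_monster) B B_elem B_new k.
have [lo [hi [c_gap H]]] :=
  local_quantifier_free M_oag M_omin cut ind0 indA pres hull tvar psi'_qf.
by exists lo, hi; split=> // i /H; rewrite -!psiE.
Qed.
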